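(* Let a slab occupying $[0,a]$, with density $\rho'(x,\omega)$ and compressibility $C'(x,\omega)$ (damping allowed), have a soft (pressure-free) backing at $x=a$ and be adjacent, in $x<0$, to a uniform acoustic medium of density $\rho$ and compressibility $C$, with sound speed $c=(C\rho)^{-1/2}$. Let $R(\omega)$ be its reflection coefficient. Then $$\int_0^\infty \operatorname{Re}\bigl(1+R(\omega)\bigr)\,\frac{d\omega}{\omega^2}=\frac{\pi a}{c}\,\frac{\langle \rho_0'\rangle}{\rho},$$ where $\rho_0'(x)=\rho'(x,0)$ is the static density and $\langle f\rangle=\frac1a\int_0^a f(x)\,dx$.
   Context: Time dependence is $e^{-i\omega t}$. The constants $\rho,C,a>0$ are given; $c=(C\rho)^{-1/2}$, $z=(\rho/C)^{1/2}$, $k=\omega/c$. Slab properties: for $x\in[0,a]$ and $\operatorname{Im}\omega\ge 0$, $\rho'(x,\omega)$ and $C'(x,\omega)$ are bounded, measurable in $x$, continuous in $\omega$ on the closed upper half plane and analytic for $\operatorname{Im}\omega>0$ (causality), satisfy $\rho'(x,-\omega^* )=\rho'(x,\omega)^*$ and $C'(x,-\omega^* )=C'(x,\omega)^*$ (real-valued time-domain response), and $\operatorname{Im}(\omega\rho')\ge0$, $\operatorname{Im}(\omega C')\ge 0$ for $\operatorname{Im}\omega\ge0$ (passivity). The static values $\rho_0'(x)=\rho'(x,0)$, $C_0'(x)=C'(x,0)$ are real, positive and bounded away from zero, and $\rho'(x,\omega)=\rho_0'(x)+O(\omega)$, $C'(x,\omega)=C_0'(x)+O(\omega)$ uniformly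 in $x$ as $\omega\to0$. The undamped case is that of real positive $\rho',C'$ independent of $\omega$. Propagator: $\mathbf M(x,\omega)$ is the $2\times2$ matrix solution of $$\frac{d\mathbf M}{dx}=i\omega\,\mathbf Q\,\mathbf M,\quad \mathbf M(0,\omega)=\mathbf I,\quad \mathbf Q(x,\omega)=\begin{pmatrix}0&C'(x,\omega)\\ \rho'(x,\omega)&0\end{pmatrix},$$ which propagates the vector $(v,p)^T$ of particle velocity and pressure. Write $M_{ij}$ for the entries of $\mathbf M(a,\omega)$. Reflection coefficient: the pressure is $p=e^{ikx}+R\,e^{-ikx}$ for $x<0$, $p$ and $v$ are continuous at $x=0$, and the soft backing imposes $p(a)=0$; equivalently $$R(\omega)=-\frac{zM_{22}+M_{21}}{zM_{22}-M_{21}}.$$ *)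

(* Defs.v *)
(* MathComp-Analysis, over an arbitrary R : realType; complex numbers are R[i]. *)
From HB Require Import structures.
From mathcomp Require Import all_boot all_order all_algebra.
From mathcomp Require Import complex ring.
From mathcomp Require Import all_classical all_reals all_analysis.

Set Implicit Arguments.
Unset Strict Implicit.
Unset Printing Implicit Defensive.

Import Order.TTheory GRing.Theory Num.Theory.
Import numFieldNormedType.Exports.

Local Open Scope classical_set_scope.
Local Open Scope ring_scope.
Local Open Scope complex_scope.

(* The usual topology of the complex plane, and the complex plane as a normed
   space over itself: [derivable f w 1] is then complex differentiability. *)
#[warnings="-redundant-canonical-projection"]
HB.instance Definition _ (R : realType) :=
  NormedModule.copy R[i] R[i]^o.

(* Unqualified [Re] and [Im] are the R[i]-valued operations of numClosedFieldType;
   the R-valued projections [complex.Re] and [complex.Im] are used throughout. *)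
Definition closed_upper_half {R : realType} : set R[i] :=
  [set w | 0 <= complex.Im w].

Definition open_upper_half {R : realType} : set R[i] :=
  [set w | 0 < complex.Im w].

(* The standing assumptions on a material parameter q(x, w) of a slab occupying
   [0, a]; both the density and the compressibility are required to satisfy
   them. Boundedness is joint in (x, w). R[i] carries no measurable structure in
   the library, hence measurability by components. The norm on R[i] takes its
   values in R[i], hence the injections [%:C]. *)
Record slab_parameter {R : realType} (a : R) (q : R -> R[i] -> R[i]) : Prop := {
  slab_bounded : exists B : R, forall (x : R) (w : R[i]),
    x \in `[0, a] -> closed_upper_half w -> `|q x w| <= B%:C;
  slab_measurable_Re : forall w : R[i], closed_upper_half w ->
    measurable_fun `[0, a] (fun x : R => complex.Re (q x w));
  slab_measurable_Im : forall w : R[i], closed_upper_half w ->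
    measurable_fun `[0, a] (fun x : R => complex.Im (q x w));
  slab_continuous : forall x : R, x \in `[0, a] ->
    {within closed_upper_half, continuous (q x)};
  slab_analytic : forall (x : R) (w : R[i]),
    x \in `[0, a] -> open_upper_half w ->
    derivable (q x) w 1;
  slab_real_response : forall (x : R) (w : R[i]),
    x \in `[0, a] -> closed_upper_half w ->
    q x (- conjc w) = conjc (q x w);
  slab_passive : forall (x : R) (w : R[i]),
    x \in `[0, a] -> closed_upper_half w ->
    0 <= complex.Im (w * q x w);
  slab_static_real : forall x : R, x \in `[0, a] -> complex.Im (q x 0) = 0;
  slab_static_pos : exists2 m : R, 0 < m &
    forall x : R, x \in `[0, a] -> m <= complex.Re (q x 0);
  slab_static_expansion : exists K : R, exists2 delta : R, 0 < delta &
    forall (x : R) (w : R[i]),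
      x \in `[0, a] -> closed_upper_half w -> `|w| <= delta%:C ->
      `|q x w - q x 0| <= K%:C * `|w|
}.

Definition complex_integral {R : realType} (D : set R) (f : R -> R[i]) : R[i] :=
  (\int[lebesgue_measure]_(t in D) complex.Re (f t))%R +i*
  (\int[lebesgue_measure]_(t in D) complex.Im (f t))%R.

(* The system matrix Q(x, w) = (0, C'; rho', 0) acting on (v, p)^T. *)
Definition system_mx {R : realType} (rho' C' : R -> R[i] -> R[i])
    (x : R) (w : R[i]) : 'M[R[i]]_2 :=
  \matrix_(i, j) if i == j then 0 else if i == 0 then C' x w else rho' x w.

(* dM/dx = i w Q M on [0, a], M(0) = I. As Q is merely measurable in x, a
   solution is understood in the sense of Caratheodory: M is continuous and
   M(x) = I + i w \int_0^x Q M, entrywise. *)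
Definition is_propagator {R : realType} (a : R) (rho' C' : R -> R[i] -> R[i])
    (w : R[i]) (M : R -> 'M[R[i]]_2) : Prop :=
  forall i j,
    {within `[0, a], continuous (fun x : R => M x i j)} /\
    forall x : R, x \in `[0, a] ->
      M x i j = (1%:M : 'M[R[i]]_2) i j
        + 'i%C * w * complex_integral `[0, x]
                     (fun t => (system_mx rho' C' t w *m M t) i j).

(* Reflection coefficient of the slab with a soft backing, for an exterior
   impedance z; N is the propagator across the whole slab. In the 1-based
   notation of the literature, N 1 0 is M_21 and N 1 1 is M_22. *)
Definition soft_reflection {R : realType} (z : R) (N : 'M[R[i]]_2) : R[i] :=
  - ((z%:C * N 1 1 + N 1 0) / (z%:C * N 1 1 - N 1 0)).

(* The exterior field e^{ikx} + r e^{-ikx} has p(0) = 1 + r and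
   v(0) = (1 - r) / z; the soft backing requires p(a) = 0. *)
Lemma soft_reflectionP {R : realType} (z : R) (N : 'M[R[i]]_2) (r : R[i]) :
  z != 0 -> z%:C * N 1 1 - N 1 0 != 0 ->
  N 1 0 * ((1 - r) / z%:C) + N 1 1 * (1 + r) = 0 <-> r = soft_reflection z N.
Proof.
rewrite /soft_reflection; move: (N 1 0) (N 1 1) => m n z0 d0.
have zC0 : z%:C != 0 by rewrite fmorph_eq0.
have -> : m * ((1 - r) / z%:C) + n * (1 + r)
        = (r * (z%:C * n - m) + (z%:C * n + m)) / z%:C.
  by field.
split=> [/eqP|->]; last by rewrite mulNr divfK// addNr mul0r.
rewrite mulf_eq0 invr_eq0 (negbTE zC0) orbF addr_eq0 => /eqP e.
by apply: (mulIf d0); rewrite e mulNr divfK.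
Qed.

Definition slab_mean {R : realType} (a : R) (f : R -> R) : R :=
  a^-1 * (\int[lebesgue_measure]_(x in `[0, a]) f x)%R.

(* Main.v *)
(* Write psurf = 1 + R for the pressure at the front face. Passivity makes the
   energy flux Re(p^* v) decrease into the slab, so zM_22 - M_21 has no zero in
   the closed upper half-plane, |R| <= 1 there and Re psurf >= 0. The Wronskian of
   the fields at two frequencies expresses psurf(w') - psurf(w) as an integral over
   the slab of the increments of w rho' and w C' against the fields; hence psurf is
   continuous up to the real axis and, since Cauchy's estimate dominates the
   difference quotients of the analytic material parameters, holomorphic inside.
   At low frequency psurf(w) = - i b w + O(w^2) with b = (2 / z) \int_0^a rho'_0.

   The function psurf(w) / w^2, with its pole at 0 removed by a term whose real
   part on the real axis is - b / (1 + t^2), is integrated over the boundary of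
   [0, L] x [e, e + L]. It is real on the imaginary axis, so the left side adds
   nothing to the real part, and the top and right sides are O(1 / L). As e tends
   to 0, \int_0^L Re psurf(t) / t^2 dt = b atan L + O(1 / L).

   Cauchy's theorem is needed for rectangles only (Goursat's bisection); circles
   are sides of rectangles in logarithmic coordinates. *)
Require Import Defs.
From mathcomp Require Import all_boot all_order all_algebra.
From mathcomp Require Import complex ring lra.
From mathcomp Require Import all_classical all_reals all_analysis.
From mathcomp Require Import measurable_realfun.

Set Implicit Arguments.
Unset Strict Implicit.
Unset Printing Implicit Defensive.

Import Order.TTheory GRing.Theory Num.Theory.
Import numFieldNormedType.Exports.

Local Open Scope classical_set_scope.
Local Open Scope ring_scope.
Local Open Scope complex_scope.

(** The parameters are only bounded and measurable in x, so the fields are Lipschitz in x but in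
    general not differentiable: each differential identity is used in integrated form, and limits
    under the integral are taken by dominated convergence. Analyticity in w is given for each x
    separately; joint boundedness turns it, through Cauchy's estimate, into a Lipschitz bound whose
    constant does not depend on x. The Wronskian carries no complex conjugation, so the increment of
    psurf involves only increments of the coefficients and values of the fields. Continuity of the
    fields in w is then enough, and the propagator itself is never differentiated in w. The term i b
    w / (1 - i w) added to psurf cancels - i b w to first order, and its pole - i lies outside the
    half-plane. The quotient by w^2 therefore stays bounded near 0, which lets the lower side of the
    rectangle descend to the real axis through the origin. As Re psurf >= 0 there, convergence of
    the truncated integrals already yields integrability. *)

Local Notation normc := ComplexField.Normc.normc.
Local Notation Rez := complex.Re.
Local Notation Imz := complex.Im.
Local Notation mu := lebesgue_measure.

(** * The real-valued modulus of a complex number *)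

Section Modulus.
Context {R : realType}.
Implicit Types (x y z : R[i]) (r : R).

Lemma normc_val z : `|z| = (normc z)%:C. Proof. by []. Qed.

Lemma normc_ge0 z : 0 <= normc z.
Proof. by rewrite -ler0c -normc_val normr_ge0. Qed.

Lemma normcD x y : normc (x + y) <= normc x + normc y.
Proof. exact: le_normcD. Qed.

Lemma normcM x y : normc (x * y) = normc x * normc y.
Proof. exact: ComplexField.Normc.normcM. Qed.

Lemma normcV x : normc x^-1 = (normc x)^-1.
Proof. exact: ComplexField.Normc.normcV. Qed.

Lemma normcX x n : normc (x ^+ n) = normc x ^+ n.
Proof.
elim: n => [|n ih]; first by rewrite !expr0 ComplexField.Normc.normc1.
by rewrite !exprS normcM ih.
Qed.

Lemma normcB x y : normc (x - y) <= normc x + normc y.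
Proof. by rewrite -(normcN y) normcD. Qed.

Lemma normcBC x y : normc (x - y) = normc (y - x).
Proof. by rewrite -normcN opprB. Qed.

Lemma normc_real r : normc r%:C = `|r|.
Proof. by rewrite /= expr0n /= addr0 sqrtr_sqr. Qed.

Lemma normc_i : normc ('i%C : R[i]) = 1.
Proof. by rewrite /= expr0n /= add0r expr1n sqrtr1. Qed.

Lemma normc0 : normc (0 : R[i]) = 0.
Proof. by rewrite -(normr0 R) -normc_real. Qed.

Lemma normc1 : normc (1 : R[i]) = 1.
Proof. exact: ComplexField.Normc.normc1. Qed.

Lemma normc_eq0 z : (normc z == 0) = (z == 0).
Proof.
by apply/eqP/eqP => [/ComplexField.Normc.eq0_normc//|->]; rewrite normc0.
Qed.

Lemma normc_gt0 z : (0 < normc z) = (z != 0).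
Proof. by rewrite lt_def normc_eq0 normc_ge0 andbT. Qed.

Lemma normc_sqr z : normc z ^+ 2 = Rez z ^+ 2 + Imz z ^+ 2.
Proof. by case: z => a b /=; rewrite sqr_sqrtr// addr_ge0// sqr_ge0. Qed.

Lemma Re_le_normc z : `|Rez z| <= normc z.
Proof.
case: z => a b /=; rewrite -sqrtr_sqr ler_sqrt ?addr_ge0 ?sqr_ge0//.
by rewrite lerDl sqr_ge0.
Qed.

Lemma Im_le_normc z : `|Imz z| <= normc z.
Proof.
case: z => a b /=; rewrite -[in X in X <= _]sqrtr_sqr.
by rewrite ler_sqrt ?addr_ge0 ?sqr_ge0// lerDr sqr_ge0.
Qed.

Lemma normc_le_ReIm z : normc z <= `|Rez z| + `|Imz z|.
Proof.
case: z => a b /=; rewrite -[leRHS]ger0_norm ?addr_ge0// -sqrtr_sqr.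
rewrite ler_sqrt ?sqr_ge0// sqrrD !real_normK ?num_real// lerD2r lerDl.
by rewrite mulrn_wge0// mulr_ge0.
Qed.

Lemma RezD x y : Rez (x + y) = Rez x + Rez y.
Proof. by case: x; case: y. Qed.
Lemma ImzD x y : Imz (x + y) = Imz x + Imz y.
Proof. by case: x; case: y. Qed.
Lemma RezN x : Rez (- x) = - Rez x.
Proof. by case: x. Qed.
Lemma ImzN x : Imz (- x) = - Imz x.
Proof. by case: x. Qed.
Lemma RezB x y : Rez (x - y) = Rez x - Rez y.
Proof. by rewrite RezD RezN. Qed.
Lemma ImzB x y : Imz (x - y) = Imz x - Imz y.
Proof. by rewrite ImzD ImzN. Qed.
Lemma RezM x y : Rez (x * y) = Rez x * Rez y - Imz x * Imz y.
Proof. by case: x; case: y. Qed.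
Lemma ImzM x y : Imz (x * y) = Rez x * Imz y + Imz x * Rez y.
Proof. by case: x; case: y. Qed.
Lemma Rez_conj x : Rez (conjc x) = Rez x.
Proof. by case: x. Qed.
Lemma Imz_conj x : Imz (conjc x) = - Imz x.
Proof. by case: x. Qed.
Lemma complex_ext x y : Rez x = Rez y -> Imz x = Imz y -> x = y.
Proof. by case: x => a b; case: y => c d /= -> ->. Qed.

End Modulus.

(** * Bounded measurable real functions on a compact interval *)

Section Bounded_measurable.
Context {R : realType}.
Implicit Types (u v w : R) (f g : R -> R).

(** Unlike integrability, this class is stable under products; it contains the continuous functions
    and implies integrability, so it is the only side condition carried along. *)
Definition bmeas u v f : Prop := measurable_fun `[u, v] f /\
  exists B, forall x, x \in `[u, v] -> `|f x| <= B.

Definition rint u v f : R := (\int[mu]_(x in `[u, v]) f x)%R.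

Lemma bmeas_integrable u v f : bmeas u v f ->
  mu.-integrable `[u, v] (EFin \o f).
Proof.
move=> [mf [B fB]]; apply: measurable_bounded_integrable => //.
  by rewrite /= lebesgue_measure_itv/=; case: ifP => // _; rewrite -EFinB ltry.
exists B; split; first exact: num_real.
by move=> r Br x /= xuv; rewrite (le_trans (fB _ xuv))// ltW.
Qed.

Lemma bmeas_cst u v (k : R) : bmeas u v (fun=> k).
Proof. by split=> //; exists `|k|. Qed.

Lemma bmeasD u v f g : bmeas u v f -> bmeas u v g ->
  bmeas u v (fun x => f x + g x).
Proof.
move=> [mf [A fA]] [mg [B gB]]; split; first exact: measurable_funD.
by exists (A + B) => x xuv; rewrite (le_trans (ler_normD _ _))// lerD ?fA ?gB.
Qed.

Lemma bmeasN u v f : bmeas u v f -> bmeas u v (fun x => - f x).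
Proof.
move=> [mf [A fA]]; split; first exact: measurableT_comp.
by exists A => x xuv; rewrite normrN fA.
Qed.

Lemma bmeasB u v f g : bmeas u v f -> bmeas u v g ->
  bmeas u v (fun x => f x - g x).
Proof. by move=> bf bg; apply: bmeasD => //; apply: bmeasN. Qed.

Lemma bmeasM u v f g : bmeas u v f -> bmeas u v g ->
  bmeas u v (fun x => f x * g x).
Proof.
move=> [mf [A fA]] [mg [B gB]]; split; first exact: measurable_funM.
by exists (A * B) => x xuv; rewrite normrM ler_pM ?fA ?gB.
Qed.

Lemma bmeas_norm u v f : bmeas u v f -> bmeas u v (fun x => `|f x|).
Proof.
move=> [mf [A fA]]; split; first exact: measurableT_comp.
by exists A => x xuv; rewrite normr_id fA.
Qed.

Lemma subitv u v u' v' x : u <= u' -> v' <= v -> x \in `[u', v'] -> x \in `[u, v].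
Proof.
by rewrite !in_itv/= => uu vv /andP[ux xv]; rewrite (le_trans uu)// (le_trans xv).
Qed.

Lemma bmeas_sub u v u' v' f : u <= u' -> v' <= v -> bmeas u v f -> bmeas u' v' f.
Proof.
move=> uu vv [mf [A fA]]; split; last first.
  by exists A => x xuv; apply: fA; apply: subitv xuv.
by apply: measurable_funS mf => // x /=; apply: subitv.
Qed.

Lemma eq_bmeas u v f g : {in `[u, v], f =1 g} -> bmeas u v f -> bmeas u v g.
Proof.
move=> fg [mf [A fA]]; split; last by exists A => x xuv; rewrite -fg// fA.
by apply: eq_measurable_fun mf => x; rewrite inE /= => /fg.
Qed.

Lemma eq_rint u v f g : {in `[u, v], f =1 g} -> rint u v f = rint u v g.
Proof. by move=> fg; apply: eq_Rintegral => x; rewrite inE; apply: fg. Qed.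

Lemma rintD u v f g : bmeas u v f -> bmeas u v g ->
  rint u v (fun x => f x + g x) = rint u v f + rint u v g.
Proof. by move=> bf bg; apply: RintegralD => //; apply: bmeas_integrable. Qed.

Lemma rintZ u v (k : R) f : bmeas u v f ->
  rint u v (fun x => k * f x) = k * rint u v f.
Proof. by move=> bf; apply: RintegralZl => //; apply: bmeas_integrable. Qed.

Lemma rintN u v f : bmeas u v f -> rint u v (fun x => - f x) = - rint u v f.
Proof.
by move=> bf; rewrite -mulN1r -rintZ//; apply: eq_rint => x _; rewrite mulN1r.
Qed.

Lemma rint_cst u v (k : R) : u <= v -> rint u v (fun=> k) = k * (v - u).
Proof.
move=> uv; rewrite /rint Rintegral_cst//= lebesgue_measure_itv/= lte_fin.
by case: ltP => // vu; rewrite (@le_anti _ _ u v) ?uv// subrr.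
Qed.

Lemma le_rint u v f g : bmeas u v f -> bmeas u v g ->
  (forall x, x \in `[u, v] -> f x <= g x) -> rint u v f <= rint u v g.
Proof. by move=> bf bg fg; apply: le_Rintegral => //; apply: bmeas_integrable. Qed.

Lemma rint_ge0 u v f : (forall x, x \in `[u, v] -> 0 <= f x) -> 0 <= rint u v f.
Proof. by move=> f0; apply: Rintegral_ge0. Qed.

Lemma le_norm_rint u v f : bmeas u v f ->
  `|rint u v f| <= rint u v (fun x => `|f x|).
Proof. by move=> bf; apply: le_normr_Rintegral => //; apply: bmeas_integrable. Qed.

Lemma rint_cat u v w f : u <= v -> v <= w -> bmeas u w f ->
  rint u w f = rint u v f + rint v w f.
Proof.
move=> uv vw bf; have bi := bmeas_integrable bf.
have := Rintegral_itvB (a := BLeft u) (b := BRight w) (x := v) bi.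
rewrite !bnd_simp => /(_ uv vw) /eqP.
rewrite subr_eq addrC => /eqP; rewrite /rint => ->; congr (_ + _).
rewrite Rintegral_itv_obnd_cbnd//; apply: integrableS bi => //.
by move=> x /=; rewrite !in_itv/= => /andP[vx ->]; rewrite (le_trans uv)// ltW.
Qed.

Lemma rint_point u f : rint u u f = 0.
Proof. by rewrite /rint set_itv1 Rintegral_set1. Qed.

Lemma bmeas_continuous u v f : {within `[u, v], continuous f} -> bmeas u v f.
Proof.
move=> cf; split; first exact: subspace_continuous_measurable_fun.
have [uv|vu] := leP u v; last first.
  exists 0 => x; rewrite in_itv/= => /andP[ux xv].
  by have := le_lt_trans (le_trans ux xv) vu; rewrite ltxx.
have cn : {within `[u, v], continuous (fun x => `|f x|)}.
  by move=> x; apply: cvg_norm; exact: cf.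
have [c _ fc] := EVT_max uv cn.
by exists `|f c| => x /fc.
Qed.

(** Dominated convergence with one exempted point [c]: the application to the regularized kernel has
    no pointwise limit available at the origin. *)
Lemma rint_bounded_cvg u v (f_ : nat -> R -> R) f (B c : R) :
    (forall n, bmeas u v (f_ n)) -> bmeas u v f ->
    (forall n x, x \in `[u, v] -> `|f_ n x| <= B) ->
    (forall x, x \in `[u, v] -> x != c -> f_ ^~ x @ \oo --> f x) ->
  (fun n => rint u v (f_ n)) @ \oo --> rint u v f.
Proof.
move=> bf_ bf fB ff.
have [||||||_ _] := @dominated_convergence _ _ R mu `[u, v]%classic _
    (fun n => EFin \o f_ n) (EFin \o f) (fun=> B%:E).
- by [].
- by move=> n; apply/measurable_EFinP; case: (bf_ n).
- by apply/measurable_EFinP; case: bf.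
- exists [set c]; split; [by []|exact: lebesgue_measure_set1|].
  move=> x /= h; apply: contrapT => xc; apply: h => xuv.
  by apply: cvg_EFin; [exact: nearW|apply: ff => //; apply/eqP].
- by apply: (bmeas_integrable (bmeas_cst u v B)).
- by apply: aeW => x n xuv; rewrite lee_fin fB.
- move=> h; rewrite /rint /Rintegral; apply: fine_cvg.
  rewrite fineK//; apply: integrable_fin_num => //; exact: bmeas_integrable.
Qed.

Lemma bmeas_lim u v (f_ : nat -> R -> R) f B :
    (forall n, bmeas u v (f_ n)) ->
    (forall n x, x \in `[u, v] -> `|f_ n x| <= B) ->
    (forall x, x \in `[u, v] -> f_ ^~ x @ \oo --> f x) ->
  bmeas u v f.
Proof.
move=> bf_ fB ff; split.
  apply: (measurable_fun_cvg (h := f_)) => // n; by case: (bf_ n).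
exists B => x xuv.
have /cvg_lim <- // : `|f_ n x| @[n --> \oo] --> `|f x|.
  by apply: cvg_norm; apply: ff.
apply: limr_le; first by apply: is_cvg_norm; apply/cvg_ex; exists (f x); apply: ff.
by apply: nearW => n; apply: fB.
Qed.

End Bounded_measurable.

(** * Integrals of complex-valued functions, by components *)

Section Complex_integral.
Context {R : realType}.
Implicit Types (u v w : R) (f g : R -> R[i]).

Definition cbmeas u v f : Prop :=
  bmeas u v (fun x => Rez (f x)) /\ bmeas u v (fun x => Imz (f x)).

Definition cint u v f : R[i] := complex_integral `[u, v] f.

Lemma Re_cint u v f : Rez (cint u v f) = rint u v (fun x => Rez (f x)).
Proof. by []. Qed.

Lemma Im_cint u v f : Imz (cint u v f) = rint u v (fun x => Imz (f x)).
Proof. by []. Qed.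

Lemma cbmeas_cst u v (k : R[i]) : cbmeas u v (fun=> k).
Proof. by split; apply: bmeas_cst. Qed.

Lemma eq_cbmeas u v f g : {in `[u, v], f =1 g} -> cbmeas u v f -> cbmeas u v g.
Proof. by move=> fg [] rf jf; split; [move: rf|move: jf]; apply: eq_bmeas => x /fg ->. Qed.

Lemma cbmeasD u v f g : cbmeas u v f -> cbmeas u v g ->
  cbmeas u v (fun x => f x + g x).
Proof.
move=> [rf jf] [rg jg]; split.
  by apply: eq_bmeas (bmeasD rf rg) => x _; rewrite RezD.
by apply: eq_bmeas (bmeasD jf jg) => x _; rewrite ImzD.
Qed.

Lemma cbmeasN u v f : cbmeas u v f -> cbmeas u v (fun x => - f x).
Proof.
move=> [rf jf]; split.
  by apply: eq_bmeas (bmeasN rf) => x _; rewrite RezN.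
by apply: eq_bmeas (bmeasN jf) => x _; rewrite ImzN.
Qed.

Lemma cbmeasB u v f g : cbmeas u v f -> cbmeas u v g ->
  cbmeas u v (fun x => f x - g x).
Proof. by move=> bf bg; apply: cbmeasD => //; apply: cbmeasN. Qed.

Lemma cbmeasM u v f g : cbmeas u v f -> cbmeas u v g ->
  cbmeas u v (fun x => f x * g x).
Proof.
move=> [rf jf] [rg jg]; split.
  by apply: eq_bmeas (bmeasB (bmeasM rf rg) (bmeasM jf jg)) => x _; rewrite RezM.
by apply: eq_bmeas (bmeasD (bmeasM rf jg) (bmeasM jf rg)) => x _; rewrite ImzM.
Qed.

Lemma cbmeasZ u v (k : R[i]) f : cbmeas u v f -> cbmeas u v (fun x => k * f x).
Proof. by apply: cbmeasM; apply: cbmeas_cst. Qed.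

Lemma cbmeas_conj u v f : cbmeas u v f -> cbmeas u v (fun x => conjc (f x)).
Proof.
move=> [rf jf]; split; first by apply: eq_bmeas rf => x _; rewrite Rez_conj.
by apply: eq_bmeas (bmeasN jf) => x _; rewrite Imz_conj.
Qed.

Lemma cbmeas_real u v (f : R -> R) : bmeas u v f -> cbmeas u v (fun x => (f x)%:C).
Proof. by move=> bf; split=> //; apply: bmeas_cst. Qed.

Lemma cbmeas_sub u v u' v' f : u <= u' -> v' <= v ->
  cbmeas u v f -> cbmeas u' v' f.
Proof. by move=> uu vv [rf jf]; split; apply: bmeas_sub uu vv _. Qed.

Lemma cbmeas_bound u v f : cbmeas u v f ->
  exists2 B : R, 0 < B & forall x, x \in `[u, v] -> normc (f x) <= B.
Proof.
move=> [[_ [A fA]] [_ [B fB]]]; exists (`|A| + `|B| + 1) => [|x xuv].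
  by rewrite ltr_pwDr// addr_ge0.
rewrite (le_trans (normc_le_ReIm _))// ler_wpDr// lerD//.
  by rewrite (le_trans (fA _ xuv))// ler_norm.
by rewrite (le_trans (fB _ xuv))// ler_norm.
Qed.

Lemma cbmeas_intro u v f (B : R) : measurable_fun `[u, v] (fun x => Rez (f x)) ->
    measurable_fun `[u, v] (fun x => Imz (f x)) ->
    (forall x, x \in `[u, v] -> normc (f x) <= B) -> cbmeas u v f.
Proof.
move=> mr mi fB; split; split=> //; exists B => x xuv.
  exact: le_trans (Re_le_normc _) (fB _ xuv).
exact: le_trans (Im_le_normc _) (fB _ xuv).
Qed.

Lemma bmeas_normc u v f : cbmeas u v f -> bmeas u v (fun x => normc (f x)).
Proof.
move=> bf; have [B _ fB] := cbmeas_bound bf; case: bf => [[rf _] [jf _]]; split.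
  have -> : (fun x => normc (f x)) =
      (fun x => Num.sqrt (Rez (f x) ^+ 2 + Imz (f x) ^+ 2)).
    by apply/funext => x; case: (f x).
  apply: (@measurableT_comp _ _ _ _ _ _ (@Num.sqrt R)).
    by apply: continuous_measurable_fun; apply: sqrt_continuous.
  by apply: measurable_funD; apply: measurable_funX.
by exists B => x xuv; rewrite ger0_norm ?normc_ge0// fB.
Qed.

Lemma eq_cint u v f g : {in `[u, v], f =1 g} -> cint u v f = cint u v g.
Proof.
by move=> fg; apply: complex_ext; rewrite ?Re_cint ?Im_cint;
  apply: eq_rint => x /fg ->.
Qed.

Lemma cintD u v f g : cbmeas u v f -> cbmeas u v g ->
  cint u v (fun x => f x + g x) = cint u v f + cint u v g.
Proof.
move=> [rf jf] [rg jg]; apply: complex_ext.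
  rewrite RezD !Re_cint -rintD//.
  by apply: eq_rint => x _; rewrite RezD.
rewrite ImzD !Im_cint -rintD//.
by apply: eq_rint => x _; rewrite ImzD.
Qed.

Lemma cintZ u v (k : R[i]) f : cbmeas u v f ->
  cint u v (fun x => k * f x) = k * cint u v f.
Proof.
move=> [rf jf]; have bZ (k' : R) h : bmeas u v h -> bmeas u v (fun x => k' * h x).
  by move=> bh; apply: bmeasM => //; apply: bmeas_cst.
apply: complex_ext; rewrite ?RezM ?ImzM ?Re_cint ?Im_cint -!rintZ//.
  rewrite -rintN -?rintD; [|exact: bZ|exact/bmeasN/bZ|exact: bZ].
  by apply: eq_rint => x _; rewrite RezM.
rewrite -rintD; [|exact: bZ|exact: bZ].
by apply: eq_rint => x _; rewrite ImzM.
Qed.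

Lemma cintN u v f : cbmeas u v f -> cint u v (fun x => - f x) = - cint u v f.
Proof.
by move=> bf; rewrite -mulN1r -cintZ//; apply: eq_cint => x _; rewrite mulN1r.
Qed.

Lemma cintB u v f g : cbmeas u v f -> cbmeas u v g ->
  cint u v (fun x => f x - g x) = cint u v f - cint u v g.
Proof. by move=> bf bg; rewrite cintD ?cintN//; apply: cbmeasN. Qed.

Lemma cint_conj u v f : cbmeas u v f ->
  cint u v (fun x => conjc (f x)) = conjc (cint u v f).
Proof.
move=> [rf jf]; apply: complex_ext; rewrite ?Rez_conj ?Imz_conj ?Re_cint ?Im_cint.
  by apply: eq_rint => x _; rewrite Rez_conj.
by rewrite -rintN//; apply: eq_rint => x _; rewrite Imz_conj.
Qed.

Lemma cint_real u v (f : R -> R) : cint u v (fun x => (f x)%:C) = (rint u v f)%:C.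
Proof.
by apply: complex_ext; rewrite ?Re_cint ?Im_cint//= /rint /Rintegral integral0.
Qed.

Lemma cint_cst u v (k : R[i]) : u <= v -> cint u v (fun=> k) = k * (v - u)%:C.
Proof.
move=> uv; apply: complex_ext; rewrite ?Re_cint ?Im_cint rint_cst// ?RezM ?ImzM /=.
  by rewrite mulr0 subr0.
by rewrite mulr0 add0r.
Qed.

Lemma cint_cat u v w f : u <= v -> v <= w -> cbmeas u w f ->
  cint u w f = cint u v f + cint v w f.
Proof.
move=> uv vw [rf jf]; apply: complex_ext; rewrite ?RezD ?ImzD ?Re_cint ?Im_cint;
  exact: rint_cat.
Qed.

Lemma cint_point u f : cint u u f = 0.
Proof. by apply: complex_ext; rewrite ?Re_cint ?Im_cint rint_point. Qed.

(* The factor 2 comes from bounding the two components separately. *)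
Lemma normc_cint u v f (g : R -> R) : cbmeas u v f -> bmeas u v g ->
  (forall x, x \in `[u, v] -> normc (f x) <= g x) ->
  normc (cint u v f) <= 2 * rint u v g.
Proof.
move=> [rf jf] bg fg; apply: (le_trans (normc_le_ReIm _)).
rewrite Re_cint Im_cint mulr_natl mulr2n lerD//.
  apply: (le_trans (le_norm_rint rf)); apply: le_rint => // [|x xuv].
    exact: bmeas_norm.
  exact: le_trans (Re_le_normc _) (fg _ xuv).
apply: (le_trans (le_norm_rint jf)); apply: le_rint => // [|x xuv].
  exact: bmeas_norm.
exact: le_trans (Im_le_normc _) (fg _ xuv).
Qed.

Lemma normc_cint_le u v f (B : R) : u <= v -> cbmeas u v f ->
  (forall x, x \in `[u, v] -> normc (f x) <= B) ->
  normc (cint u v f) <= 2 * (B * (v - u)).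
Proof. by move=> uv bf fB; rewrite -rint_cst//; apply: normc_cint => //; apply: bmeas_cst. Qed.

End Complex_integral.

(** * Limits in the complex plane with real radii *)

Section Complex_topology.
Context {R : realType}.

(** The norm of R[i] is R[i]-valued, so its radii are complex; but a positive element of R[i] has
    zero imaginary part, hence real radii suffice. *)
Lemma cvg_normcP {T : Type} {F : set_system T} {FF : Filter F}
    (f : T -> R[i]) (l : R[i]) :
  f @ F --> l <-> forall e : R, 0 < e -> \forall t \near F, normc (f t - l) < e.
Proof.
split=> [fl e e0|h].
  have e0' : (0 : R[i]) < e%:C by rewrite ltcR.
  have /cvgrPdist_lt/(_ _ e0') := fl.
  by apply: filterS => t; rewrite normc_val ltcR normcBC.
apply/cvgrPdist_lt => e e0.
have [er ee] : 0 < Rez e /\ e = (Rez e)%:C.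
  move: e0; rewrite ltcE /= => /andP[/eqP ei er]; split => //.
  by apply: complex_ext.
rewrite ee; have := h _ er; apply: filterS => t.
by rewrite normc_val ltcR normcBC.
Qed.

Lemma nbhs_normcP (w : R[i]) (P : set R[i]) :
  nbhs w P <-> exists2 d : R, 0 < d & forall x, normc (x - w) < d -> P x.
Proof.
split=> [/nbhs_ballP[e /= e0 eP]|[d d0 dP]].
  move: e0; rewrite ltcE /= => /andP[/eqP ei er].
  exists (Rez e) => // x xw; apply: eP; rewrite -ball_normE/=.
  have -> : e = (Rez e)%:C by apply: complex_ext.
  by rewrite normc_val ltcR normcBC.
apply/nbhs_ballP; exists d%:C => /=; first by rewrite ltcR.
by move=> x; rewrite -ball_normE/= normc_val ltcR normcBC; exact: dP.
Qed.

Lemma continuous_normcP (f : R[i] -> R[i]) (w : R[i]) :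
  {for w, continuous f} <-> forall e : R, 0 < e -> exists2 d : R, 0 < d &
    forall x, normc (x - w) < d -> normc (f x - f w) < e.
Proof.
split=> [fw e e0|h].
  by apply/nbhs_normcP; apply: (cvg_normcP (F := nbhs w) f (f w)).1.
by apply: (cvg_normcP (F := nbhs w) f (f w)).2 => e /h /nbhs_normcP.
Qed.

Lemma cvg_Re {T : Type} {F : set_system T} {FF : Filter F} (f : T -> R[i]) l :
  f @ F --> l -> Rez (f t) @[t --> F] --> Rez l.
Proof.
move=> /cvg_normcP fl; apply/cvgrPdist_lt => e /fl; apply: filterS => t.
by apply: le_lt_trans; rewrite -RezB normcBC Re_le_normc.
Qed.

Lemma cvg_Im {T : Type} {F : set_system T} {FF : Filter F} (f : T -> R[i]) l :
  f @ F --> l -> Imz (f t) @[t --> F] --> Imz l.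
Proof.
move=> /cvg_normcP fl; apply/cvgrPdist_lt => e /fl; apply: filterS => t.
by apply: le_lt_trans; rewrite -ImzB normcBC Im_le_normc.
Qed.

Lemma cvg_complex {T : Type} {F : set_system T} {FF : Filter F} (f : T -> R[i]) l :
  Rez (f t) @[t --> F] --> Rez l -> Imz (f t) @[t --> F] --> Imz l ->
  f @ F --> l.
Proof.
move=> rl il; apply/cvg_normcP => e e0.
have e2 : 0 < e / 2 by rewrite divr_gt0.
move/cvgrPdist_lt/(_ _ e2) : rl; move/cvgrPdist_lt/(_ _ e2) : il.
apply: filterS2 => t it rt; rewrite normcBC (le_lt_trans (normc_le_ReIm _))//.
by rewrite RezB ImzB [ltRHS]splitr ltrD.
Qed.

Lemma cbmeas_continuous (u v : R) (f : R -> R[i]) :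
  {within `[u, v], continuous f} -> cbmeas u v f.
Proof.
by move=> cf; split; apply: bmeas_continuous => x;
  [apply: cvg_Re|apply: cvg_Im]; apply: cf.
Qed.

Lemma cbmeas_continuous_in (u v : R) (f : R -> R[i]) :
  (forall x, x \in `[u, v] -> {for x, continuous f}) -> cbmeas u v f.
Proof.
move=> cf; apply: cbmeas_continuous; apply: continuous_in_subspaceT => x.
by rewrite inE; apply: cf.
Qed.

Lemma cint_bounded_cvg u v (f_ : nat -> R -> R[i]) f (B c : R) :
    (forall n, cbmeas u v (f_ n)) -> cbmeas u v f ->
    (forall n x, x \in `[u, v] -> normc (f_ n x) <= B) ->
    (forall x, x \in `[u, v] -> x != c -> f_ ^~ x @ \oo --> f x) ->
  (fun n => cint u v (f_ n)) @ \oo --> cint u v f.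
Proof.
move=> bf_ bf fB ff; apply: cvg_complex.
  rewrite /= /cint /=.
  apply: (@rint_bounded_cvg _ _ _ (fun n x => Rez (f_ n x)) _ B c).
  - by move=> n; case: (bf_ n).
  - by case: bf.
  - by move=> n x xuv; exact: le_trans (Re_le_normc _) (fB _ _ xuv).
  - by move=> x xuv xc; apply: cvg_Re; exact: ff.
apply: (@rint_bounded_cvg _ _ _ (fun n x => Imz (f_ n x)) _ B c).
- by move=> n; case: (bf_ n).
- by case: bf.
- by move=> n x xuv; exact: le_trans (Im_le_normc _) (fB _ _ xuv).
- by move=> x xuv xc; apply: cvg_Im; exact: ff.
Qed.

Lemma cbmeas_lim u v (f_ : nat -> R -> R[i]) f (B : R) :
    (forall n, cbmeas u v (f_ n)) ->
    (forall n x, x \in `[u, v] -> normc (f_ n x) <= B) ->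
    (forall x, x \in `[u, v] -> f_ ^~ x @ \oo --> f x) ->
  cbmeas u v f.
Proof.
move=> bf_ fB ff; split.
  apply: (@bmeas_lim _ _ _ (fun n x => Rez (f_ n x)) _ B).
  - by move=> n; case: (bf_ n).
  - by move=> n x xuv; exact: le_trans (Re_le_normc _) (fB _ _ xuv).
  - by move=> x xuv; apply: cvg_Re; exact: ff.
apply: (@bmeas_lim _ _ _ (fun n x => Imz (f_ n x)) _ B).
- by move=> n; case: (bf_ n).
- by move=> n x xuv; exact: le_trans (Im_le_normc _) (fB _ _ xuv).
- by move=> x xuv; apply: cvg_Im; exact: ff.
Qed.

End Complex_topology.

(** Closes a chain of estimates by an identity left to [ring] or [field]. *)
Lemma eq_ler (R : realType) (x y : R) : x = y -> x <= y.
Proof. by move=> ->. Qed.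

(** * Continuity of integrals depending on a complex parameter *)

Section Parameter_limits.
Context {R : realType}.

Lemma cvg_within_normcP (D : set R[i]) (w : R[i]) (f : R[i] -> R[i]) (l : R[i]) :
  f @ within D (nbhs w) --> l <-> forall e : R, 0 < e -> exists2 d : R, 0 < d &
    forall x, D x -> normc (x - w) < d -> normc (f x - l) < e.
Proof.
have FF : Filter (within D (nbhs w)) by exact: within_filter.
split=> [fl e e0|h].
  have h := (cvg_normcP (FF := FF) f l).1 fl _ e0.
  have [d d0 dP] := (nbhs_normcP w (fun x => D x -> normc (f x - l) < e)).1 h.
  by exists d => // x Dx xd; apply: dP.
apply: (cvg_normcP (FF := FF) f l).2 => e /h[d d0 dP].
apply: (nbhs_normcP w (fun x => D x -> normc (f x - l) < e)).2.
by exists d => // x xd Dx; apply: dP.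
Qed.

Lemma cvg_seq_within (D : set R[i]) (w : R[i]) (f : R[i] -> R[i]) (l : R[i])
    (u : nat -> R[i]) (d0 : R) : 0 < d0 ->
    (forall n, D (u n)) -> (forall n, normc (u n - w) < d0 / n.+1%:R) ->
  f @ within D (nbhs w) --> l -> (fun n => f (u n)) @ \oo --> l.
Proof.
move=> d00 Du uw /cvg_within_normcP fl; apply/cvg_normcP => e /fl[d dp dP].
have [N _ NP] : \forall n \near \oo, d0 / n.+1%:R < d.
  have : (fun n : nat => d0 * n.+1%:R^-1) @ \oo --> (d0 * 0 : R).
    by apply: cvgMr; exact: cvg_harmonic.
  rewrite mulr0 => /cvgrPdist_lt/(_ _ dp); apply: filterS => n.
  by rewrite sub0r normrN ger0_norm// divr_ge0// ltW.
by exists N => // n /NP nd; apply: dP => //; apply: lt_trans (uw _) nd.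
Qed.

(** Dominated convergence is about sequences. If the limit along the filter failed, points of [D] at
    distance less than [d0 / (n + 1)] from [w] could be chosen with integrals bounded away from the
    limit. Measurability of [phi0] comes from the same sequence. *)
Lemma cint_param_cvg (u v : R) (D : set R[i]) (w : R[i])
    (phi : R[i] -> R -> R[i]) (phi0 : R -> R[i]) (B d0 : R) : 0 < d0 ->
    (forall z, D z -> normc (z - w) < d0 -> cbmeas u v (phi z)) ->
    (forall z x, D z -> normc (z - w) < d0 -> x \in `[u, v] ->
       normc (phi z x) <= B) ->
    (forall x, x \in `[u, v] -> phi ^~ x @ within D (nbhs w) --> phi0 x) ->
  (fun z => cint u v (phi z)) @ within D (nbhs w) --> cint u v phi0.
Proof.
move=> d00 bphi phiB phil; apply/cvg_within_normcP => e e0.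
apply: contrapT => nex.
have H n : exists z : R[i], [/\ D z, normc (z - w) < d0 / n.+1%:R &
    ~ normc (cint u v (phi z) - cint u v phi0) < e].
  apply: contrapT => nez; apply: nex; exists (d0 / n.+1%:R).
    by rewrite divr_gt0.
  by move=> z Dz zw; apply: contrapT => ze; apply: nez; exists z.
have [s sP] := choice H.
have sD n : D (s n) by case: (sP n).
have sw n : normc (s n - w) < d0 / n.+1%:R by case: (sP n).
have sd n : normc (s n - w) < d0.
  by rewrite (lt_le_trans (sw n))// ler_pdivrMr// ler_peMr ?ler1n// ltW.
have ls x : x \in `[u, v] -> (fun n => phi (s n) x) @ \oo --> phi0 x.
  by move=> /phil; apply: cvg_seq_within sD sw.
have b0 : cbmeas u v phi0.
  apply: (cbmeas_lim (f_ := fun n => phi (s n)) (B := B)) => // [n|n x xuv].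
    exact: bphi.
  exact: phiB.
have /cvg_normcP/(_ e e0)[N _ /(_ N)/= h] : (fun n => cint u v (phi (s n))) @ \oo --> cint u v phi0.
  apply: (cint_bounded_cvg (B := B) (c := v + 1)) => // [n|n x xuv|x xuv _].
  - exact: bphi.
  - exact: phiB.
  - exact: ls.
by case: (sP N) => _ _; apply; apply: h.
Qed.

End Parameter_limits.

(** * Gronwall's inequality and the product rule for integral equations *)

Section Integral_equations.
Context {R : realType}.

Lemma rint_expR (L x : R) : 0 <= x ->
  rint 0 x (fun t => L * expR (L * t)) = expR (L * x) - 1.
Proof.
rewrite le_eqVlt => /predU1P[<-|x0].
  by rewrite rint_point mulr0 expR0 subrr.
have dF (t : R) : is_derive t 1 (fun t => expR (L * t)) (L * expR (L * t)).
  by apply: is_derive_eq; rewrite !scaler1/= /GRing.scale/=; ring.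
have cF : continuous (fun t : R => expR (L * t)).
  move=> t; apply: differentiable_continuous; apply/derivable1_diffP.
  exact: ex_derive.
rewrite /rint /Rintegral (@continuous_FTC2 _ _ (fun t => expR (L * t)))//.
- by rewrite mulr0 expR0.
- apply: continuous_subspaceT => t.
  by apply: cvgMr; exact: cF.
- split.
  + by move=> t _; apply: ex_derive.
  + by apply: cvg_at_right_filter; exact: cF.
  + by apply: cvg_at_left_filter; exact: cF.
- by move=> t _; rewrite derive1E; exact: derive_val.
Qed.

(* Bielecki's weighted norm: the supremum of [y t * expR (- L t)] with
   [L = 2 K] is absorbed by half of itself. *)
Lemma gronwall (a E K : R) (y : R -> R) : 0 < K -> 0 <= a -> 0 <= E ->
    bmeas 0 a y ->
    (forall x, x \in `[0, a] -> 0 <= y x) ->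
    (forall x, x \in `[0, a] -> y x <= E + K * rint 0 x y) ->
  forall x, x \in `[0, a] -> y x <= 2 * E * expR (2 * K * a).
Proof.
move=> K0 a0 E0 by_ y0 yE.
have [_ [B yB]] := by_.
pose L := 2 * K; have L0 : 0 < L by rewrite mulr_gt0.
pose A := [set y t * expR (- (L * t)) | t in `[0, a]].
have A0 : A !=set0.
  exists (y 0 * expR (- (L * 0))); exists 0 => //=.
  by rewrite in_itv/= lexx.
have Aub : has_ubound A.
  exists B => _ [t /= ta <-].
  have B0 : `|y t| <= B by apply: yB.
  rewrite -[leRHS]mulr1 ler_pM ?y0 ?expR_ge0//.
    by rewrite (le_trans (ler_norm _)).
  rewrite -expR0 ler_expR oppr_le0 mulr_ge0// ?(ltW L0)//.
  by move: ta; rewrite in_itv/= => /andP[].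
pose S := sup A.
have yS t : t \in `[0, a] -> y t <= S * expR (L * t).
  move=> ta; rewrite -ler_pdivrMr ?expR_gt0// -expRN.
  by apply: ub_le_sup => //; exists t.
have S0 : 0 <= S.
  have z0 : (0 : R) \in `[0, a] by rewrite in_itv/= lexx.
  by have := le_trans (y0 _ z0) (yS _ z0); rewrite mulr0 expR0 mulr1.
have bexp (k : R) x : bmeas 0 x (fun t => k * expR (L * t)).
  apply: bmeas_continuous; apply: continuous_subspaceT => t.
  apply: cvgMr; apply: (@continuous_comp _ _ _ (fun t => L * t) expR).
    by apply: cvgMr; exact: cvg_id.
  exact: continuous_expR.
have SE : S <= E + S / 2.
  apply: ge_sup => // _ [t /= ta <-].
  have [t0 tle] : 0 <= t /\ t <= a by move: ta; rewrite in_itv/= => /andP.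
  (* Under the integral, [yS] gives K y <= (S / 2) L exp(L s), since K = L / 2. *)
  have h : K * rint 0 t y <= S / 2 * (expR (L * t) - 1).
    have byt : bmeas 0 t y by apply: bmeas_sub by_.
    rewrite -rint_expR// -(rintZ K byt) -(rintZ (S / 2) (bexp L t)).
    apply: le_rint.
    - by apply: bmeasM; [exact: bmeas_cst|].
    - by apply: bmeasM; [exact: bmeas_cst|exact: bexp].
    - move=> s st; have sa : s \in `[0, a] by exact: subitv st.
      have := yS _ sa; rewrite -(ler_pM2l K0) => /le_trans; apply.
      by rewrite /L; apply: eq_ler; field.
  have eL : expR (L * t) * expR (- (L * t)) = 1 by rewrite expRxMexpNx_1.
  have e1 : expR (- (L * t)) <= 1.
    by rewrite -expR0 ler_expR oppr_le0 mulr_ge0// ltW.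
  have := le_trans (yE _ ta) (lerD (lexx E) h).
  rewrite -(ler_pM2r (expR_gt0 (- (L * t)))) => /le_trans; apply.
  rewrite mulrDl -[X in _ + X]mulrA mulrBl eL mul1r lerD//.
    by rewrite ler_piMr.
  by rewrite ler_piMr ?divr_ge0// lerBlDr lerDl expR_ge0.
have S2 : S <= 2 * E by lra.
move=> x xa; apply: (le_trans (yS _ xa)).
apply: ler_pM => //.
rewrite ler_expR ler_pM2l//.
by move: xa; rewrite in_itv/= => /andP[].
Qed.

(** Over [n] equal steps the increments add up to at most K a^2 / n, which is arbitrarily small. *)
Lemma quadratic_increment_const (H : R -> R[i]) (a K : R) : 0 <= a ->
    (forall x y, 0 <= x -> x <= y -> y <= a ->
       normc (H y - H x) <= K * (y - x) ^+ 2) ->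
  H a = H 0.
Proof.
move=> a0 HK; apply/eqP; rewrite -subr_eq0 -normc_eq0; apply/eqP.
apply/eqP; rewrite eq_le normc_ge0 andbT; apply/ler_addgt0Pr => e e0.
rewrite add0r.
have K0 : 0 <= K * a ^+ 2.
  by have := HK 0 a (lexx _) a0 (lexx _); rewrite subr0; apply: le_trans; rewrite normc_ge0.
(* Chosen so that K a^2 / n <= e. *)
pose n := (Num.truncn (K * a ^+ 2 / e)).+1.
have n0 : 0 < n%:R :> R by rewrite ltr0n.
have step k : (k <= n)%N ->
    normc (H (k%:R * (a / n%:R)) - H 0) <= k%:R * (K * (a / n%:R) ^+ 2).
  elim: k => [|k ih] kn; first by rewrite !mul0r subrr normc0.
  have an : 0 <= a / n%:R by rewrite divr_ge0// ltW.
  rewrite -(subrK (H (k%:R * (a / n%:R))) (H _)) -addrA.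
  rewrite (le_trans (normcD _ _))// [in leRHS]mulrS [in leRHS]mulrDl mul1r lerD ?ih// ?(ltnW kn)//.
  apply: (le_trans (HK _ _ _ _ _)).
  - by rewrite mulr_ge0.
  - by rewrite ler_wpM2r// ler_nat.
  - by rewrite mulrCA ler_piMr// ler_pdivrMr// mul1r ler_nat.
  - by rewrite -mulrBl -natrB// subSnn mul1r.
have := step n (leqnn n); rewrite mulrCA divff ?gt_eqF// mulr1 => /le_trans; apply.
rewrite expr_div_n (_ : n%:R * _ = (K * a ^+ 2) / n%:R); last first.
  by field; rewrite gt_eqF.
rewrite ler_pdivrMr// -ler_pdivrMl// mulrC.
by apply/ltW/truncnS_gt.
Qed.

Lemma cint_sub_lipschitz (a : R) (f F : R -> R[i]) : cbmeas 0 a f ->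
    (forall x, x \in `[0, a] -> F x = F 0 + cint 0 x f) ->
  forall x y, 0 <= x -> x <= y -> y <= a -> F y - F x = cint x y f.
Proof.
move=> bf FE x y x0 xy ya.
have xa : x <= a by exact: le_trans ya.
rewrite FE ?in_itv/= ?(le_trans x0)// [F x]FE ?in_itv/= ?x0//.
rewrite (@cint_cat _ 0 x y)//; last by apply: cbmeas_sub bf.
by rewrite opprD addrACA subrr add0r addrAC subrr add0r.
Qed.

(** [F] and [G] need not be differentiable. The defect [H] of the identity has increments equal to
    the integral over [x, y] of f(t) (G(y) - G(t)) + (F(x) - F(t)) g(t), and the differences are O(y
    - x), so the increments are quadratic and [H] is constant. *)
Lemma cint_product_rule (a : R) (f g F G : R -> R[i]) : 0 <= a ->
    cbmeas 0 a f -> cbmeas 0 a g -> cbmeas 0 a F -> cbmeas 0 a G ->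
    (forall x, x \in `[0, a] -> F x = F 0 + cint 0 x f) ->
    (forall x, x \in `[0, a] -> G x = G 0 + cint 0 x g) ->
  F a * G a = F 0 * G 0 + cint 0 a (fun t => f t * G t + F t * g t).
Proof.
move=> a0 bf bg bF bG FE GE.
have [A A0 fA] := cbmeas_bound bf; have [B B0 gB] := cbmeas_bound bg.
have Fi := cint_sub_lipschitz bf FE; have Gi := cint_sub_lipschitz bg GE.
pose h t := f t * G t + F t * g t.
have bh : cbmeas 0 a h by apply: cbmeasD; apply: cbmeasM.
pose H x := F x * G x - cint 0 x h.
suff: H a = H 0.
  by rewrite /H cint_point subr0 => /eqP; rewrite subr_eq => /eqP ->.
apply: (@quadratic_increment_const H a (8 * (A * B))) => // x y x0 xy ya.
have sub (k : R -> R[i]) : cbmeas 0 a k -> cbmeas x y k by apply: cbmeas_sub.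
have xyP t : t \in `[x, y] -> [/\ 0 <= t, x <= t, t <= y & t <= a].
  by rewrite in_itv/= => /andP[xt ty]; split=> //; [exact: le_trans xt|exact: le_trans ya].
have -> : H y - H x = cint x y (fun t => f t * (G y - G t)) +
                      cint x y (fun t => (F x - F t) * g t).
  rewrite -cintD; last 2 first.
  - by apply: cbmeasM; [exact: sub|apply: cbmeasB; [exact: cbmeas_cst|exact: sub]].
  - by apply: cbmeasM; [apply: cbmeasB; [exact: cbmeas_cst|exact: sub]|exact: sub].
  rewrite (_ : H y - H x = G y * cint x y f + F x * cint x y g - cint x y h); last first.
    rewrite -Fi// -Gi// /H (@cint_cat _ 0 x y)//; first by ring.
    by apply: cbmeas_sub bh.
  rewrite -!cintZ; [|exact: sub|exact: sub].
  rewrite -cintD; [|by apply: cbmeasZ; exact: sub..].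
  rewrite -cintB; [|by apply: cbmeasD; apply: cbmeasZ; exact: sub|exact: sub].
  by apply: eq_cint => t _; rewrite /h; ring.
have xy0 : 0 <= y - x by rewrite subr_ge0.
have inta t : t \in `[x, y] -> t \in `[0, a].
  by case/xyP => t0 _ _ ta; rewrite in_itv/= t0 ta.
have M1 : normc (cint x y (fun t => f t * (G y - G t))) <=
    2 * ((A * (2 * (B * (y - x)))) * (y - x)).
  apply: normc_cint_le => //.
    by apply: cbmeasM; [exact: sub|apply: cbmeasB; [exact: cbmeas_cst|exact: sub]].
  move=> t txy; have [t0 xt ty ta] := xyP _ txy.
  rewrite normcM ler_pM ?normc_ge0 ?fA ?inta// Gi//.
  apply: (@le_trans _ _ (2 * (B * (y - t)))).
    apply: normc_cint_le => //; first by apply: cbmeas_sub bg.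
    by move=> s sty; apply: gB; apply: subitv sty.
  by rewrite ler_pM2l// ler_pM2l// lerD2l lerN2.
have M2 : normc (cint x y (fun t => (F x - F t) * g t)) <=
    2 * (((2 * (A * (y - x))) * B) * (y - x)).
  apply: normc_cint_le => //.
    by apply: cbmeasM; [apply: cbmeasB; [exact: cbmeas_cst|exact: sub]|exact: sub].
  move=> t txy; have [t0 xt ty ta] := xyP _ txy.
  rewrite normcM ler_pM ?normc_ge0 ?gB ?inta// normcBC Fi//.
  apply: (@le_trans _ _ (2 * (A * (t - x)))).
    apply: normc_cint_le => //; first by apply: cbmeas_sub bf.
    by move=> s sty; apply: fA; apply: subitv sty.
  by rewrite ler_pM2l// ler_pM2l// lerD2r.
apply: (le_trans (normcD _ _)); apply: (le_trans (lerD M1 M2)).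
by apply: eq_ler; ring.
Qed.

End Integral_equations.

Arguments ComplexField.Normc.normc : simpl never.
Arguments cint : simpl never.

(** * Arithmetic of complex limits *)

Section Complex_limits.
Context {R : realType} {T : Type} {F : set_system T} {FF : Filter F}.
Implicit Types (f g : T -> R[i]) (l m : R[i]).

Lemma complex_cvgD f g l m : f @ F --> l -> g @ F --> m ->
  (fun t => f t + g t) @ F --> l + m.
Proof.
move=> fl gm; apply: cvg_complex.
  rewrite RezD; under eq_fun do rewrite RezD.
  by apply: cvgD; apply: cvg_Re.
rewrite ImzD; under eq_fun do rewrite ImzD.
by apply: cvgD; apply: cvg_Im.
Qed.

Lemma complex_cvgN f l : f @ F --> l -> (fun t => - f t) @ F --> - l.
Proof.
move=> fl; apply: cvg_complex.
  rewrite RezN; under eq_fun do rewrite RezN.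
  by apply: cvgN; apply: cvg_Re.
rewrite ImzN; under eq_fun do rewrite ImzN.
by apply: cvgN; apply: cvg_Im.
Qed.

Lemma complex_cvgM f g l m : f @ F --> l -> g @ F --> m ->
  (fun t => f t * g t) @ F --> l * m.
Proof.
move=> fl gm; apply: cvg_complex.
  rewrite RezM; under eq_fun do rewrite RezM.
  by apply: cvgB; apply: cvgM; do [exact: cvg_Re|exact: cvg_Im].
rewrite ImzM; under eq_fun do rewrite ImzM.
by apply: cvgD; apply: cvgM; do [exact: cvg_Re|exact: cvg_Im].
Qed.

Lemma RezV (z : R[i]) : Rez z^-1 = Rez z / (Rez z ^+ 2 + Imz z ^+ 2).
Proof. by case: z. Qed.

Lemma ImzV (z : R[i]) : Imz z^-1 = - Imz z / (Rez z ^+ 2 + Imz z ^+ 2).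
Proof. by case: z => a b /=; rewrite mulNr. Qed.

Lemma complex_cvgV f l : l != 0 -> f @ F --> l -> (fun t => (f t)^-1) @ F --> l^-1.
Proof.
move=> l0 fl.
have n0 : Rez l ^+ 2 + Imz l ^+ 2 != 0.
  by rewrite -normc_sqr expf_neq0// normc_eq0.
have cn : (Rez (f t) ^+ 2 + Imz (f t) ^+ 2)^-1 @[t --> F] -->
          (Rez l ^+ 2 + Imz l ^+ 2)^-1.
  apply: cvgV => //; rewrite !expr2; under eq_fun do rewrite !expr2.
  by apply: cvgD; apply: cvgM; do [exact: cvg_Re|exact: cvg_Im].
apply: cvg_complex.
  rewrite RezV; under eq_fun do rewrite RezV.
  by apply: cvgM => //; exact: cvg_Re.
rewrite ImzV; under eq_fun do rewrite ImzV.
by apply: cvgM => //; apply: cvgN; exact: cvg_Im.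
Qed.

End Complex_limits.

(** * Complex continuity and differentiability *)

Section Complex_differentiability.
Context {R : realType}.
Implicit Types (F G : R[i] -> R[i]) (w : R[i]).

Definition ccont F w : Prop := forall e : R, 0 < e -> exists2 d : R, 0 < d &
  forall x, normc (x - w) < d -> normc (F x - F w) < e.

Lemma ccontP F w : ccont F w <-> F @ nbhs w --> F w.
Proof. by split=> [/continuous_normcP|/continuous_normcP]; exact. Qed.

Lemma ccont_cst (k w : R[i]) : ccont (fun=> k) w.
Proof. by move=> e e0; exists 1 => // x _; rewrite subrr normc0. Qed.

Lemma ccont_id w : ccont (fun x => x) w.
Proof. by move=> e e0; exists e. Qed.

Lemma ccontD F G w : ccont F w -> ccont G w -> ccont (fun x => F x + G x) w.
Proof.
move=> /ccontP cF /ccontP cG; apply/ccontP.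
exact: (complex_cvgD (FF := nbhs_filter w) cF cG).
Qed.

Lemma ccontN F w : ccont F w -> ccont (fun x => - F x) w.
Proof.
by move=> /ccontP cF; apply/ccontP; exact: (complex_cvgN (FF := nbhs_filter w) cF).
Qed.

Lemma ccontB F G w : ccont F w -> ccont G w -> ccont (fun x => F x - G x) w.
Proof. by move=> cF cG; exact: (ccontD cF (ccontN cG)). Qed.

Lemma ccontM F G w : ccont F w -> ccont G w -> ccont (fun x => F x * G x) w.
Proof.
move=> /ccontP cF /ccontP cG; apply/ccontP.
exact: (complex_cvgM (FF := nbhs_filter w) cF cG).
Qed.

Lemma ccontV F w : F w != 0 -> ccont F w -> ccont (fun x => (F x)^-1) w.
Proof.
move=> F0 /ccontP cF; apply/ccontP.
exact: (complex_cvgV (FF := nbhs_filter w) F0 cF).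
Qed.

Lemma ccont_comp F G w : ccont G w -> ccont F (G w) -> ccont (fun x => F (G x)) w.
Proof.
move=> cG cF e /cF[d1 d10 h1]; have [d2 d20 h2] := cG _ d10.
by exists d2 => // x /h2/h1.
Qed.

(* Caratheodory's form of complex differentiability: the difference quotient at
   [w] extends continuously. *)
Definition cdiff F w := exists2 Phi : R[i] -> R[i], ccont Phi w &
  forall w', F w' = F w + Phi w' * (w' - w).

(** [cdiff] asks for a global factorization, but away from [w] the difference quotient itself
    provides it. Inverses need this: their factorization breaks down where the function vanishes. *)
Lemma cdiff_near F w (Phi : R[i] -> R[i]) : ccont Phi w ->
  (\forall w' \near w, F w' = F w + Phi w' * (w' - w)) -> cdiff F w.
Proof.
move=> cP nF.
exists (fun w' => if w' == w then Phi w else (F w' - F w) / (w' - w)).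
  move=> e e0; rewrite eqxx.
  have [d1 d10 dP1] := cP e e0.
  have [d2 d20 dP2] := (nbhs_normcP _ _).1 nF.
  exists (Num.min d1 d2) => [|x]; first by rewrite lt_min d10.
  rewrite lt_min => /andP[x1 x2]; case: eqP => [_|/eqP xw].
    by rewrite subrr normc0.
  by rewrite (dP2 _ x2) addrAC subrr add0r mulfK ?subr_eq0// dP1.
move=> w'; case: eqP => [->|/eqP ww]; first by rewrite subrr mulr0 addr0.
by rewrite divfK ?subr_eq0// addrC subrK.
Qed.

Lemma cdiff_continuous F w : cdiff F w -> ccont F w.
Proof.
move=> [Phi cP FE].
have -> : F = (fun w' => F w + Phi w' * (w' - w)) by apply/funext.
apply: ccontD; first exact: ccont_cst.
apply: ccontM; first exact: cP.
by apply: ccontB; [exact: ccont_id|exact: ccont_cst].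
Qed.

Lemma derivable_cdiff F w : derivable F w 1 -> cdiff F w.
Proof.
move=> /cvg_ex[/= d dF].
exists (fun w' => if w' == w then d else (F w' - F w) / (w' - w)); last first.
  move=> w'; case: eqP => [->|/eqP ww]; first by rewrite subrr mulr0 addr0.
  by rewrite divfK ?subr_eq0// addrC subrK.
move=> e e0; rewrite eqxx.
have [d1 d10 dP] := (cvg_within_normcP _ 0 _ d).1 dF e e0.
exists d1 => // x xw; case: eqP => [_|/eqP xn].
  by rewrite (subrr (d : R[i])) normc0.
have := dP (x - w); rewrite subr0 subr_eq0 => /(_ xn xw).
by rewrite /= scaler1 subrK /GRing.scale/= mulrC.
Qed.

Lemma cdiff_approx F w : cdiff F w -> exists d : R[i], forall e : R, 0 < e ->
  exists2 delta : R, 0 < delta & forall w', normc (w' - w) < delta ->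
    normc (F w' - F w - d * (w' - w)) <= e * normc (w' - w).
Proof.
move=> [Phi cP FE]; exists (Phi w) => e /cP[d d0 dP].
exists d => // w' /dP h; rewrite (FE w') (addrC (F w)) addrK -mulrBl normcM.
by rewrite ler_wpM2r ?normc_ge0// ltW.
Qed.

Lemma cdiff_cst (k w : R[i]) : cdiff (fun=> k) w.
Proof.
exists (fun=> 0); first exact: ccont_cst.
by move=> w'; rewrite mul0r addr0.
Qed.

Lemma cdiff_id w : cdiff id w.
Proof.
exists (fun=> 1); first exact: ccont_cst.
by move=> w'; rewrite mul1r addrC subrK.
Qed.

Lemma cdiffD F G w : cdiff F w -> cdiff G w -> cdiff (fun x => F x + G x) w.
Proof.
move=> [P cP FE] [Q cQ GE]; exists (fun x => P x + Q x); first exact: ccontD.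
by move=> w'; rewrite FE GE; ring.
Qed.

Lemma cdiffM F G w : cdiff F w -> cdiff G w -> cdiff (fun x => F x * G x) w.
Proof.
move=> dF dG; have cG := cdiff_continuous dG.
case: dF dG => [P cP FE] [Q cQ GE].
exists (fun x => P x * G x + F w * Q x).
  by apply: ccontD; apply: ccontM => //; exact: ccont_cst.
by move=> w'; rewrite (FE w') [in LHS](GE w') [G w' in RHS](GE w'); ring.
Qed.

Lemma cdiffB F G w : cdiff F w -> cdiff G w -> cdiff (fun x => F x - G x) w.
Proof.
move=> [P cP FE] [Q cQ GE]; exists (fun x => P x - Q x); first exact: ccontB.
by move=> w'; rewrite FE GE; ring.
Qed.

Lemma cdiffV F w : F w != 0 -> cdiff F w -> cdiff (fun x => (F x)^-1) w.
Proof.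
move=> Fw0 dF; have cF := cdiff_continuous dF; case: dF => [P cP FE].
have nF : \forall w' \near w, F w' != 0.
  have := cF; move=> /(_ (normc (F w))); rewrite normc_gt0 => /(_ Fw0)[d d0 dP].
  apply/nbhs_normcP; exists d => // x /dP; apply: contraTneq => ->.
  by rewrite sub0r normcN ltxx.
apply: (@cdiff_near _ _ (fun x => - P x / (F x * F w))).
  apply: ccontM; first exact: ccontN.
  by apply: ccontV; [rewrite mulf_neq0|apply: ccontM => //; exact: ccont_cst].
move: nF; apply: filterS => w' Fw'.
have e : P w' * (w' - w) = F w' - F w by rewrite [in RHS]FE addrAC subrr add0r.
rewrite !mulNr mulrAC e; field.
by rewrite Fw0 Fw'.
Qed.

Lemma cdiff_comp F G w : cdiff G w -> cdiff F (G w) -> cdiff (fun x => F (G x)) w.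
Proof.
move=> dG; have cG := cdiff_continuous dG; case: dG => [Q cQ GE] [P cP FE].
exists (fun x => P (G x) * Q x).
  by apply: ccontM => //; exact: (ccont_comp cG cP).
move=> w'; have e : G w' - G w = Q w' * (w' - w) by rewrite [in LHS]GE; ring.
by rewrite FE e; ring.
Qed.

Lemma continuous_hline F (x y : R) : ccont F (x +i* y) ->
  {for x, continuous (fun t : R => F (t +i* y))}.
Proof.
move=> cF; rewrite /prop_for /continuous_at.
apply/cvg_normcP => e /cF[d d0 dP].
apply/nbhs_ballP; exists d => //= t; rewrite /ball/= => td; apply: dP.
rewrite (_ : _ - _ = (t - x)%:C); first by rewrite normc_real distrC.
by rewrite -complexr0; apply: complex_ext => /=; rewrite ?subrr.
Qed.

Lemma continuous_vline F (x y : R) : ccont F (x +i* y) ->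
  {for y, continuous (fun t : R => F (x +i* t))}.
Proof.
move=> cF; rewrite /prop_for /continuous_at.
apply/cvg_normcP => e /cF[d d0 dP].
apply/nbhs_ballP; exists d => //= t; rewrite /ball/= => td; apply: dP.
rewrite (_ : _ - _ = 'i * (t - y)%:C).
  by rewrite normcM normc_i mul1r normc_real distrC.
by apply: complex_ext; rewrite ?(RezB, ImzB, RezM, ImzM) /=; ring.
Qed.

End Complex_differentiability.

(** * Cauchy's theorem for rectangles *)

Lemma half_interval (R : realType) (u v p w : R) : 0 <= w -> u <= p ->
    p + (w + w) <= v -> forall p', p' = p \/ p' = p + w ->
  [/\ u <= p', p' + w <= v, p <= p' & p' + w <= p + (w + w)].
Proof. by move=> w0 up pv p' [] ->; split; lra. Qed.

Lemma four_lt_sum (R : realType) (j j1 j2 j3 j4 : R) :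
  4 * j1 < j -> 4 * j2 < j -> 4 * j3 < j -> 4 * j4 < j ->
  ~ j <= (j1 + j2) + (j3 + j4).
Proof. by move=> ? ? ? ?; apply/negP; rewrite -ltNge; lra. Qed.

Section Goursat.
Context {R : realType}.
Variable F : R[i] -> R[i].

Definition in_rect (x0 x1 y0 y1 : R) (w : R[i]) : Prop :=
  [/\ x0 <= Rez w, Rez w <= x1, y0 <= Imz w & Imz w <= y1].

(* The integral of [F] along the boundary of [x0, x1] x [y0, y1], counter-clockwise. *)
Definition rectint (x0 x1 y0 y1 : R) : R[i] :=
  cint x0 x1 (fun x => F (x +i* y0) - F (x +i* y1)) +
  'i * cint y0 y1 (fun y => F (x1 +i* y) - F (x0 +i* y)).

Let hline x0 x1 y0 y1 y :
  (forall w, in_rect x0 x1 y0 y1 w -> ccont F w) ->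
  y0 <= y -> y <= y1 -> cbmeas x0 x1 (fun x => F (x +i* y)).
Proof.
move=> cF y0y yy1; apply: cbmeas_continuous_in => x; rewrite in_itv/= => /andP[x0x xx1].
by apply: continuous_hline; apply: cF; split.
Qed.

Let vline x0 x1 y0 y1 x :
  (forall w, in_rect x0 x1 y0 y1 w -> ccont F w) ->
  x0 <= x -> x <= x1 -> cbmeas y0 y1 (fun y => F (x +i* y)).
Proof.
move=> cF x0x xx1; apply: cbmeas_continuous_in => y; rewrite in_itv/= => /andP[y0y yy1].
by apply: continuous_vline; apply: cF; split.
Qed.

Lemma rectint_splitx x0 x x1 y0 y1 :
  (forall w, in_rect x0 x1 y0 y1 w -> ccont F w) ->
  x0 <= x -> x <= x1 -> y0 <= y1 ->
  rectint x0 x1 y0 y1 = rectint x0 x y0 y1 + rectint x x1 y0 y1.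
Proof.
move=> cF x0x xx1 y01; have x01 := le_trans x0x xx1; rewrite /rectint.
rewrite (@cint_cat _ x0 x x1)//; last by apply: cbmeasB; apply: (hline cF).
rewrite 3?(@cintB _ y0 y1); try by apply: (vline cF).
  by ring.
Qed.

Lemma rectint_splity x0 x1 y0 y y1 :
  (forall w, in_rect x0 x1 y0 y1 w -> ccont F w) ->
  x0 <= x1 -> y0 <= y -> y <= y1 ->
  rectint x0 x1 y0 y1 = rectint x0 x1 y0 y + rectint x0 x1 y y1.
Proof.
move=> cF x01 y0y yy1; have y01 := le_trans y0y yy1; rewrite /rectint.
rewrite (@cint_cat _ y0 y y1)//; last by apply: cbmeasB; apply: (vline cF).
rewrite 3?(@cintB _ x0 x1); try by apply: (hline cF).
  by ring.
Qed.

(** An affine function integrates to zero around a rectangle, so only the remainder [r] of the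
    first-order expansion counts. It is at most e / 4 times the half-perimeter [s], which also
    bounds the distance of any point of the rectangle from [w]. *)
Lemma rectint_local w : cdiff F w -> forall e : R, 0 < e ->
  exists2 delta : R, 0 < delta & forall x0 x1 y0 y1 : R,
    (forall w, in_rect x0 x1 y0 y1 w -> ccont F w) ->
    in_rect x0 x1 y0 y1 w -> (x1 - x0) + (y1 - y0) < delta ->
    normc (rectint x0 x1 y0 y1) <= e * ((x1 - x0) + (y1 - y0)) ^+ 2.
Proof.
move=> /cdiff_approx[d dF] e e0.
(* The 4 absorbs the 2 of [normc_cint_le] and the two opposite sides in each integrand. *)
have e4 : 0 < e / 4 by rewrite divr_gt0.
have [delta delta0 hd] := dF _ e4; exists delta => // x0 x1 y0 y1 cF rw small.
have [x01 y01] : x0 <= x1 /\ y0 <= y1.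
  by case: rw => ? ? ? ?; split; [apply: (le_trans (y := Rez w))|apply: (le_trans (y := Imz w))].
set s := (x1 - x0) + (y1 - y0) in small *.
have sx : 0 <= x1 - x0 by rewrite subr_ge0.
have sy : 0 <= y1 - y0 by rewrite subr_ge0.
pose r z := F z - F w - d * (z - w).
have rB z : in_rect x0 x1 y0 y1 z -> normc (r z) <= e / 4 * s.
  move=> rz; have zw : normc (z - w) <= s.
    apply: (le_trans (normc_le_ReIm _)); rewrite RezB ImzB.
    case: rw rz => [? ? ? ?] [? ? ? ?]; rewrite lerD// ler_norml; apply/andP; split; lra.
  apply: (le_trans (hd _ _)); first exact: le_lt_trans small.
  by rewrite ler_pM2l.
pose g1 x := r (x +i* y0) - r (x +i* y1).
pose g2 y := r (x1 +i* y) - r (x0 +i* y).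
have bh y : y0 <= y -> y <= y1 -> cbmeas x0 x1 (fun x => F (x +i* y)).
  exact: hline.
have bv x : x0 <= x -> x <= x1 -> cbmeas y0 y1 (fun y => F (x +i* y)).
  exact: vline.
have b1 : cbmeas x0 x1 g1.
  apply: (@eq_cbmeas _ _ _ (fun x => F (x +i* y0) - F (x +i* y1) + d * 'i * (y1 - y0)%:C)).
    move=> x _; rewrite /g1 /r.
    have -> : (x +i* y1 - w) = (x +i* y0 - w) + 'i * (y1 - y0)%:C.
      by apply: complex_ext; rewrite ?(RezB, ImzB, RezD, ImzD, RezM, ImzM) /=; ring.
    by ring.
  by apply: cbmeasD; [apply: cbmeasB; exact: bh|exact: cbmeas_cst].
have b2 : cbmeas y0 y1 g2.
  apply: (@eq_cbmeas _ _ _ (fun y => F (x1 +i* y) - F (x0 +i* y) - d * (x1 - x0)%:C)).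
    move=> y _; rewrite /g2 /r.
    have -> : (x1 +i* y - w) = (x0 +i* y - w) + (x1 - x0)%:C.
      by apply: complex_ext; rewrite ?(RezB, ImzB, RezD, ImzD, RezM, ImzM) /=; ring.
    by ring.
  by apply: cbmeasB; [apply: cbmeasB; exact: bv|exact: cbmeas_cst].
have -> : rectint x0 x1 y0 y1 = cint x0 x1 g1 + 'i * cint y0 y1 g2.
  rewrite /rectint.
  rewrite (@eq_cint _ x0 x1 _ (fun x => g1 x - d * 'i * (y1 - y0)%:C)); last first.
    move=> x _; rewrite /g1 /r.
    have -> : (x +i* y1 - w) = (x +i* y0 - w) + 'i * (y1 - y0)%:C.
      by apply: complex_ext; rewrite ?(RezB, ImzB, RezD, ImzD, RezM, ImzM) /=; ring.
    by ring.
  rewrite (@eq_cint _ y0 y1 _ (fun y => g2 y + d * (x1 - x0)%:C)); last first.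
    move=> y _; rewrite /g2 /r.
    have -> : (x1 +i* y - w) = (x0 +i* y - w) + (x1 - x0)%:C.
      by apply: complex_ext; rewrite ?(RezB, ImzB, RezD, ImzD, RezM, ImzM) /=; ring.
    by ring.
  rewrite (cintB b1 (cbmeas_cst _ _ _)) (cintD b2 (cbmeas_cst _ _ _)) !cint_cst//.
  by ring.
have B1 : normc (cint x0 x1 g1) <= 2 * ((e / 4 * s + e / 4 * s) * (x1 - x0)).
  apply: normc_cint_le => // x; rewrite in_itv/= => /andP[? ?].
  by rewrite (le_trans (normcB _ _))// lerD// rB//; split.
have B2 : normc (cint y0 y1 g2) <= 2 * ((e / 4 * s + e / 4 * s) * (y1 - y0)).
  apply: normc_cint_le => // x; rewrite in_itv/= => /andP[? ?].
  by rewrite (le_trans (normcB _ _))// lerD// rB//; split.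
apply: (le_trans (normcD _ _)); rewrite normcM normc_i mul1r.
apply: (le_trans (lerD B1 B2)).
by apply: eq_ler; rewrite /s; field.
Qed.

Lemma nested_intervals (u v : nat -> R) :
    (forall n, u n <= u n.+1) -> (forall n, v n.+1 <= v n) ->
    (forall n, u n <= v n) ->
  exists p, forall n, u n <= p /\ p <= v n.
Proof.
move=> iu dv uv.
have mu_ m n : (m <= n)%N -> u m <= u n.
  elim: n => [|n ih]; first by rewrite leqn0 => /eqP ->.
  by rewrite leq_eqVlt ltnS => /predU1P[->//|/ih/le_trans]; apply.
have mv m n : (m <= n)%N -> v n <= v m.
  elim: n => [|n ih]; first by rewrite leqn0 => /eqP ->.
  by rewrite leq_eqVlt ltnS => /predU1P[->//|/ih]; apply: le_trans.
have uv' m n : u m <= v n.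
  have [mn|nm] := leqP m n; first exact: le_trans (mu_ _ _ mn) (uv n).
  exact: le_trans (uv m) (mv _ _ (ltnW nm)).
exists (sup (range u)) => n; split.
  by apply: ub_le_sup; [exists (v 0%N) => _ [m _ <-]|exists n].
by apply: ge_sup; [exists (u 0%N); exists 0%N|move=> _ [m _ <-]].
Qed.

Theorem goursat x0 x1 y0 y1 : x0 <= x1 -> y0 <= y1 ->
  (forall w, in_rect x0 x1 y0 y1 w -> cdiff F w) -> rectint x0 x1 y0 y1 = 0.
Proof.
move=> x01 y01 dF.
pose W := x1 - x0; pose H := y1 - y0.
have W0 : 0 <= W by rewrite subr_ge0.
have H0 : 0 <= H by rewrite subr_ge0.
pose q n : R := 2^-1 ^+ n.
have q0 n : 0 < q n by rewrite exprn_gt0.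
have qS n : q n = q n.+1 + q n.+1 by rewrite /q exprS; field.
pose J n (p : R * R) := normc (rectint p.1 (p.1 + W * q n) p.2 (p.2 + H * q n)).
pose inside n (p : R * R) := [/\ x0 <= p.1, p.1 + W * q n <= x1, y0 <= p.2 &
  p.2 + H * q n <= y1].
have Wq n : 0 <= W * q n by rewrite mulr_ge0// ltW.
have Hq n : 0 <= H * q n by rewrite mulr_ge0// ltW.
have cF x x' y y' : x0 <= x -> x' <= x1 -> y0 <= y -> y' <= y1 ->
    forall w, in_rect x x' y y' w -> ccont F w.
  move=> hx hx' hy hy' w [a b c d]; apply: cdiff_continuous; apply: dF; split.
  - exact: le_trans a.
  - exact: le_trans hx'.
  - exact: le_trans c.
  - exact: le_trans hy'.
(* Some quarter carries at least a fourth of the modulus. Taking pairs [(n, p)] and putting [inside]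
   as a premise makes the selection total, as [choice] requires. *)
have step (np : nat * (R * R)) : exists p' : R * R, let: (n, p) := np in
    inside n p -> [/\ inside n.+1 p', p.1 <= p'.1 /\ p'.1 + W * q n.+1 <= p.1 + W * q n,
      p.2 <= p'.2 /\ p'.2 + H * q n.+1 <= p.2 + H * q n & J n p <= 4 * J n.+1 p'].
  case: np => n [x y].
  have [|nin] := pselect (inside n (x, y)); last by exists (x, y) => /nin.
  move=> [/= a b c d].
  have eW : W * q n = W * q n.+1 + W * q n.+1 by rewrite qS mulrDr.
  have eH : H * q n = H * q n.+1 + H * q n.+1 by rewrite qS mulrDr.
  have := Wq n.+1; have := Hq n.+1.
  set wn := W * q n.+1 in eW *; set hn := H * q n.+1 in eH * => hn0 wn0.
  have E : rectint x (x + W * q n) y (y + H * q n) =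
      (rectint x (x + wn) y (y + hn) + rectint (x + wn) (x + wn + wn) y (y + hn)) +
      (rectint x (x + wn) (y + hn) (y + hn + hn) +
       rectint (x + wn) (x + wn + wn) (y + hn) (y + hn + hn)).
    rewrite (@rectint_splity _ _ _ (y + hn)); last 4 first.
    - by apply: cF => //; lra.
    - by lra.
    - by lra.
    - by lra.
    have sx y' y'' : y0 <= y' -> y' <= y'' -> y'' <= y1 ->
        rectint x (x + wn + wn) y' y'' =
        rectint x (x + wn) y' y'' + rectint (x + wn) (x + wn + wn) y' y''.
      move=> ? ? ?; apply: rectint_splitx => //; rewrite ?lerDl//.
      by apply: cF => //; lra.
    by rewrite eW eH (addrA x) (addrA y) !sx//; lra.
  have : exists p', [/\ p' \in [:: (x, y); (x + wn, y); (x, y + hn); (x + wn, y + hn)]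
      & J n (x, y) <= 4 * J n.+1 p'].
    apply: contrapT => nex.
    have lt p : p \in [:: (x, y); (x + wn, y); (x, y + hn); (x + wn, y + hn)] ->
        4 * J n.+1 p < J n (x, y).
      by move=> pin; rewrite ltNge; apply/negP => ?; apply: nex; exists p.
    have l1 := lt (x, y); have l2 := lt (x + wn, y); have l3 := lt (x, y + hn).
    have l4 := lt (x + wn, y + hn).
    move: l1 l2 l3 l4; rewrite !inE !eqxx /= ?orbT.
    move=> /(_ isT) l1 /(_ isT) l2 /(_ isT) l3 /(_ isT) l4.
    have : J n (x, y) <= (J n.+1 (x, y) + J n.+1 (x + wn, y)) +
                         (J n.+1 (x, y + hn) + J n.+1 (x + wn, y + hn)).
      have JE m b1 b2 : J m (b1, b2) =
        normc (rectint b1 (b1 + W * q m) b2 (b2 + H * q m)) by [].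
      rewrite !JE E -/wn -/hn.
      by rewrite (le_trans (normcD _ _))// lerD// normcD.
    exact: four_lt_sum l1 l2 l3 l4.
  case=> p' [pin Jp]; exists p' => _.
  have [px py] : (p'.1 = x \/ p'.1 = x + wn) /\ (p'.2 = y \/ p'.2 = y + hn).
    by move: pin; rewrite !inE => /or4P[] /eqP -> /=; split; by [left|right].
  rewrite eW in b; rewrite eH in d.
  have [i1 i2 i3 i4] := half_interval wn0 a b px.
  have [k1 k2 k3 k4] := half_interval hn0 c d py.
  by rewrite eW eH.
have [f fP] := choice step.
pose s := fix s n := if n is m.+1 then f (m, s m) else (x0, y0).
have s_in n : inside n (s n).
  elim: n => [|n ih]; first by rewrite /inside /= /q expr0 !mulr1 /W /H; split; lra.
  by case: (fP (n, s n) ih).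
have sP n := fP (n, s n) (s_in n).
have p4 n : 0 < 4 ^+ n :> R by rewrite exprn_gt0.
have sJ n : J 0%N (s 0%N) <= 4 ^+ n * J n (s n).
  elim: n => [|n ih]; first by rewrite expr0 mul1r.
  apply: (le_trans ih); rewrite exprSr -mulrA (ler_pM2l (p4 n)).
  by case: (sP n).
have [px pxP] : exists px, forall n, (s n).1 <= px /\ px <= (s n).1 + W * q n.
  apply: nested_intervals => n.
  - by case: (sP n) => _ [].
  - by case: (sP n) => _ [].
  - by rewrite lerDl.
have [py pyP] : exists py, forall n, (s n).2 <= py /\ py <= (s n).2 + H * q n.
  apply: nested_intervals => n.
  - by case: (sP n) => _ _ [].
  - by case: (sP n) => _ _ [].
  - by rewrite lerDl.
have pin n : in_rect (s n).1 ((s n).1 + W * q n) (s n).2 ((s n).2 + H * q n) (px +i* py).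
  by case: (pxP n) (pyP n) => ? ? [? ?]; split.
have dp : cdiff F (px +i* py).
  apply: dF; case: (s_in 0%N) (pin 0%N) => [/= a b c d] [/= ? ? ? ?]; split => /=; lra.
have J0 : J 0%N (s 0%N) = normc (rectint x0 x1 y0 y1).
  have e1 : x0 + W * q 0%N = x1 by rewrite /q expr0 mulr1 addrC subrK.
  have e2 : y0 + H * q 0%N = y1 by rewrite /q expr0 mulr1 addrC subrK.
  rewrite (_ : J _ _ = normc (rectint x0 (x0 + W * q 0%N) y0 (y0 + H * q 0%N)))//.
  by rewrite e1 e2.
apply/eqP; rewrite -normc_eq0 eq_le normc_ge0 andbT; apply/ler_addgt0Pr => e e0.
rewrite add0r -J0.
(* The 1 keeps [S] positive when the rectangle is a single point. *)
pose S := W + H + 1; have S0 : 0 < S by rewrite /S; lra.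
have e' : 0 < e / S ^+ 2 by rewrite divr_gt0// exprn_gt0.
have [delta d0 loc] := rectint_local dp e'.
have [n qn] : exists n, S * q n < delta.
  have : (fun n => S * q n) @ \oo --> S * 0.
    by apply: cvgMr; apply: cvg_expr; rewrite ger0_norm// invf_lt1 ?ltr1n.
  rewrite mulr0 => /cvgrPdist_lt/(_ _ d0)[N _ /(_ N (leqnn N))].
  rewrite sub0r normrN ger0_norm ?mulr_ge0 ?(ltW S0) ?(ltW (q0 _))// => ?.
  by exists N.
have ew : (s n).1 + W * q n - (s n).1 + ((s n).2 + H * q n - (s n).2) = (W + H) * q n.
  by ring.
have WHS : (W + H) * q n <= S * q n by rewrite ler_pM2r// /S lerDl.
have [i1 i2 i3 i4] := s_in n.
have := loc _ _ _ _ (cF _ _ _ _ i1 i2 i3 i4) (pin n).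
rewrite ew => /(_ (le_lt_trans WHS qn)) Jn.
rewrite (le_trans (sJ n))//.
(* The loss 4^n of the bisection is exactly compensated by the square of the half-perimeter in
   [rectint_local]. *)
have q4 : 4 ^+ n * q n ^+ 2 = 1.
  rewrite /q -exprM mulnC exprM -exprMn (_ : 4 * 2^-1 ^+ 2 = 1) ?expr1n//.
  by field.
apply: (@le_trans _ _ (4 ^+ n * (e / S ^+ 2 * (S * q n) ^+ 2))).
  rewrite (ler_pM2l (p4 n)) (le_trans Jn)// ler_pM2l// ler_sqr ?nnegrE//.
    by rewrite mulr_ge0 ?(ltW (q0 _))// addr_ge0.
  by rewrite mulr_ge0 ?(ltW S0) ?(ltW (q0 _)).
apply: eq_ler; rewrite exprMn.
have -> : 4 ^+ n * (e / S ^+ 2 * (S ^+ 2 * q n ^+ 2)) = 4 ^+ n * q n ^+ 2 * (e * (S ^+ 2 / S ^+ 2)).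
  by ring.
by rewrite q4 mul1r divff ?mulr1// expf_neq0// gt_eqF.
Qed.

End Goursat.

(** * Real derivatives as first-order approximations *)

Section Real_derivative_approximation.
Context {R : realType}.
Implicit Types (f : R -> R) (x df : R).

Lemma is_derive_approx f x df : is_derive x 1 f df -> forall e : R, 0 < e ->
  exists2 d : R, 0 < d &
    forall t, `|t| < d -> `|f (x + t) - f x - df * t| <= e * `|t|.
Proof.
move=> [/cvg_ex[/= l fl] dfl] e e0.
have ldf : l = df by rewrite -dfl; apply/esym/cvg_lim.
move: fl; rewrite ldf => /cvgrPdist_le/(_ _ e0)/nbhs_ballP[d /= d0 dP].
exists d => // t td; have [->|t0] := eqVneq t 0.
  by rewrite addr0 subrr mulr0 subrr normr0 mulr0.
have := dP t; rewrite /ball/= sub0r normrN => /(_ td t0).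
rewrite scaler1 /GRing.scale/= -(ler_pM2r (_ : 0 < `|t|)) ?normr_gt0//.
rewrite -normrM mulrBl mulrAC mulVf// mul1r distrC.
by rewrite [t + x]addrC.
Qed.

Lemma approx_is_derive f x df : (forall e : R, 0 < e -> exists2 d : R, 0 < d &
    forall t, `|t| < d -> `|f (x + t) - f x - df * t| <= e * `|t|) ->
  is_derive x 1 f df.
Proof.
move=> h; have fl : h^-1 *: (f (h *: (1 : R) + x) - f x) @[h --> (0 : R)^'] --> df.
  apply/cvgrPdist_le => e /h[d d0 dP]; apply/nbhs_ballP; exists d => //= t.
  rewrite /ball/= sub0r normrN => td t0; have := dP _ td.
  rewrite scaler1 /GRing.scale/= [t + x]addrC distrC => ft.
  rewrite -(ler_pM2r (_ : 0 < `|t|)) ?normr_gt0//.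
  by rewrite -normrM mulrBl mulrAC mulVf// mul1r.
apply: DeriveDef; first by apply/cvg_ex; exists df.
exact/cvg_lim.
Qed.

End Real_derivative_approximation.

(** * The complex exponential *)

Section Complex_exponential.
Context {R : realType}.
Implicit Types (w z : R[i]).

Lemma approx_cdiff (F : R[i] -> R[i]) w d : (forall e : R, 0 < e ->
    exists2 delta : R, 0 < delta & forall h, normc h < delta ->
      normc (F (w + h) - F w - d * h) <= e * normc h) ->
  cdiff F w.
Proof.
move=> H; exists (fun w' => if w' == w then d else (F w' - F w) / (w' - w)); last first.
  move=> w'; case: eqP => [->|/eqP ww]; first by rewrite subrr mulr0 addr0.
  by rewrite divfK ?subr_eq0// addrC subrK.
move=> e e0; rewrite eqxx; have [delta d0 dP] := H (e / 2) (divr_gt0 e0 (ltr0Sn _ 1)).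
exists delta => // x xw; case: eqP => [_|/eqP xn].
  by rewrite (subrr (d : R[i])) normc0.
have xw0 : x - w != 0 by rewrite subr_eq0.
have := dP _ xw; rewrite (addrC w) subrK => h.
have -> : (F x - F w) / (x - w) - d = (F x - F w - d * (x - w)) / (x - w).
  by rewrite [RHS]mulrBl mulfK.
rewrite normcM normcV ltr_pdivrMr ?normc_gt0// (le_lt_trans h)//.
by rewrite ltr_pM2r ?normc_gt0// ltr_pdivrMr// mulr_natr mulr2n ltrDl.
Qed.

Definition cexp w : R[i] :=
  (expR (Rez w))%:C * (cos (Imz w) +i* sin (Imz w)).

Lemma normc_cis (t : R) : normc (cos t +i* sin t) = 1.
Proof. by rewrite /ComplexField.Normc.normc cos2Dsin2 sqrtr1. Qed.

Lemma normc_cexp w : normc (cexp w) = expR (Rez w).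
Proof. by rewrite normcM normc_cis mulr1 normc_real ger0_norm ?expR_ge0. Qed.

Lemma cexpD w z : cexp (w + z) = cexp w * cexp z.
Proof.
rewrite /cexp RezD ImzD expRD cosD sinD.
by apply: complex_ext; rewrite ?(RezM, ImzM) /=; ring.
Qed.

Lemma cexp_2ipi w : cexp (w + 0 +i* (pi *+ 2)) = cexp w.
Proof.
rewrite cexpD; have -> : cexp (0 +i* (pi *+ 2)) = 1.
  by rewrite /cexp /= expR0 cos2pi sin2pi mul1r.
by rewrite mulr1.
Qed.

(** By [cexpD] only the expansion at 0 matters. There exp(s) (cos t + i sin t) - 1 - s - i t splits
    into the remainder of exp, the remainders of cos and sin multiplied by 1 + s, and the cross term
    i s t. *)
Lemma cdiff_cexp w : cdiff cexp w.
Proof.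
apply: (@approx_cdiff _ _ (cexp w)) => e e0.
(* 6 = 1 + 4 + 1 collects the bounds [e1], [e2], [e3]; the exponential is the modulus of
   [cexp w]. *)
pose e' := e / (6 * expR (Rez w)).
have e'0 : 0 < e' by rewrite divr_gt0// mulr_gt0// expR_gt0.
have [d1 d10 hexp] := is_derive_approx (is_derive_expR (0 : R)) e'0.
have [d2 d20 hcos] := is_derive_approx (is_derive_cos (0 : R)) e'0.
have [d3 d30 hsin] := is_derive_approx (is_derive_sin (0 : R)) e'0.
(* The bound 1 serves |1 + s| <= 2 and the bound [e'] serves the cross term i s t. *)
exists (Num.min (Num.min d1 d2) (Num.min d3 (Num.min 1 e'))) => [|[s t]].
  by rewrite !lt_min d10 d20 d30 ltr01 e'0.
rewrite !lt_min => /andP[/andP[h1 h2] /and3P[h3 h4 h5]].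
set z := s +i* t in h1 h2 h3 h4 h5 *.
have sz : `|s| <= normc z by exact: Re_le_normc z.
have tz : `|t| <= normc z by exact: Im_le_normc z.
have zE : z = s%:C + 'i * t%:C.
  by apply: complex_ext; rewrite ?(RezD, ImzD, RezM, ImzM) /=; ring.
have := hexp s (le_lt_trans sz h1); rewrite add0r expR0 mul1r => {}hexp.
have := hcos t (le_lt_trans tz h2); rewrite add0r cos0 sin0 oppr0 mul0r subr0 => {}hcos.
have := hsin t (le_lt_trans tz h3); rewrite add0r sin0 cos0 mul1r subr0 => {}hsin.
set c := cos t +i* sin t.
have e1 : normc ((expR s - 1 - s)%:C * c) <= e' * normc z.
  rewrite normcM normc_cis mulr1 normc_real (le_trans hexp)//.
  by rewrite ler_wpM2l// ltW.
have e2 : normc ((1 + s)%:C * (c - 1 - 'i * t%:C)) <= 4 * (e' * normc z).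
  rewrite normcM normc_real (_ : 4 = 2 * 2); last by ring.
  rewrite -mulrA ler_pM ?normc_ge0//.
    by rewrite (le_trans (ler_normD _ _))// normr1 lerD// ltW// (le_lt_trans sz).
  apply: (le_trans (normc_le_ReIm _)).
  have -> : Rez (c - 1 - 'i * t%:C) = cos t - 1 by rewrite !(RezB, RezM) /=; ring.
  have -> : Imz (c - 1 - 'i * t%:C) = sin t - t by rewrite !(ImzB, ImzM) /=; ring.
  rewrite mulr_natl mulr2n lerD//; first rewrite (le_trans hcos)//.
    by rewrite ler_wpM2l// ltW.
  by rewrite (le_trans hsin)// ler_wpM2l// ltW.
have e3 : normc ('i * s%:C * t%:C) <= e' * normc z.
  rewrite !normcM normc_i mul1r !normc_real mulrC ler_pM//.
  by rewrite (le_trans tz)// ltW.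
have -> : cexp (w + z) - cexp w - cexp w * z = cexp w *
    ((expR s - 1 - s)%:C * c + (1 + s)%:C * (c - 1 - 'i * t%:C) + 'i * s%:C * t%:C).
  have cz : cexp z = (expR s)%:C * c by [].
  by rewrite cexpD cz zE !rmorphB !rmorphD !rmorph1 /=; ring.
rewrite normcM normc_cexp.
have : normc ((expR s - 1 - s)%:C * c + (1 + s)%:C * (c - 1 - 'i * t%:C) + 'i * s%:C * t%:C)
    <= 6 * (e' * normc z).
  apply: (le_trans (normcD _ _)).
  apply: (le_trans (lerD (normcD _ _) (lexx _))).
  apply: (le_trans (lerD (lerD e1 e2) e3)).
  by apply: eq_ler; ring.
rewrite -(ler_pM2l (expR_gt0 (Rez w))) => /le_trans; apply.
by apply: eq_ler; rewrite /e'; field; rewrite gt_eqF// expR_gt0.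
Qed.

End Complex_exponential.

(** * Cauchy's estimate and a Lipschitz bound *)

Section Cauchy_estimate.
Context {R : realType}.

(* In the coordinates w + exp(s + i t) the circles around [w] are the vertical
   sides of a rectangle whose horizontal sides cancel by periodicity. *)
Lemma cauchy_estimate (h : R[i] -> R[i]) (w : R[i]) (r B : R) : 0 < r ->
    (forall z, normc (z - w) <= r -> cdiff h z) ->
    (forall z, normc (z - w) <= r -> normc (h z) <= B) ->
  exists2 d : R[i], normc d <= 4 * B / r & forall e : R, 0 < e ->
    exists2 delta : R, 0 < delta & forall w', normc (w' - w) < delta ->
      normc (h w' - h w - d * (w' - w)) <= e * normc (w' - w).
Proof.
move=> r0 dh hB.
have ww : normc (w - w) <= r by rewrite subrr normc0 ltW.
have [d dP] := cdiff_approx (dh _ ww); exists d => //.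
apply/ler_addgt0Pr => e e0.
have e2 : 0 < e / 2 by rewrite divr_gt0.
have [delta delta0 hd] := dP _ e2.
pose m := Num.min delta r / 2.
have m0 : 0 < m by rewrite divr_gt0// lt_min delta0 r0.
have mle : m < Num.min delta r.
  by rewrite /m ltr_pdivrMr// mulr_natr mulr2n ltrDl lt_min delta0 r0.
have [md mr] : m < delta /\ m < r by move: mle; rewrite lt_min => /andP.
(* The singularity of [k] at [w] is never met, because [cexp] has no zero. *)
pose k z := (h z - h w) / (z - w).
pose F (xi : R[i]) := k (w + cexp xi).
have dF xi : Rez xi <= ln r -> cdiff F xi.
  move=> xr; have E0 : cexp xi != 0 by rewrite -normc_gt0 normc_cexp expR_gt0.
  have Er : normc (w + cexp xi - w) <= r.
    by rewrite (addrC w) addrK normc_cexp -[leRHS](lnK r0) ler_expR.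
  apply: (cdiff_comp (F := k) (G := fun xi => w + cexp xi)).
    by apply: cdiffD; [exact: cdiff_cst|exact: cdiff_cexp].
  rewrite /k; apply: cdiffM.
    by apply: cdiffB; [exact: dh|exact: cdiff_cst].
  apply: cdiffV; first by rewrite (addrC w) addrK.
  by apply: cdiffB; [exact: cdiff_id|exact: cdiff_cst].
have lmr : ln m <= ln r by rewrite ler_ln ?posrE// ltW.
have pi20 : 0 <= pi *+ 2 :> R by rewrite mulrn_wge0// pi_ge0.
have : rectint F (ln m) (ln r) 0 (pi *+ 2) = 0.
  by apply: goursat => // z [_ zr _ _]; exact: dF.
have bv x : x <= ln r -> cbmeas 0 (pi *+ 2) (fun y => F (x +i* y)).
  move=> xr; apply: cbmeas_continuous_in => y _; apply: continuous_vline.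
  by apply: cdiff_continuous; apply: dF.
rewrite /rectint (@eq_cint _ _ _ _ (fun=> 0)); last first.
  move=> x _; rewrite /F; have -> : x +i* (pi *+ 2) = x +i* 0 + 0 +i* (pi *+ 2).
    by apply: complex_ext; rewrite ?(RezD, ImzD) /= ?addr0 ?add0r.
  by rewrite cexp_2ipi subrr.
rewrite (cint_cst _ lmr) mul0r add0r cintB; [|exact: bv..].
move=> /eqP; rewrite mulf_eq0 => /orP[/eqP i0|].
  by have := congr1 (@ComplexField.Normc.normc R) i0;
    rewrite normc_i normc0 => /eqP; rewrite oner_eq0.
rewrite subr_eq0 => /eqP cE.
(* By [cE] the integrals over the circles of radii [r] and [m] agree. On the outer circle the
   quotient is at most 2 B / r, on the inner one it is within e / 2 of [d]; the 2 of [normc_cint_le]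
   turns these into 4 B / r and e. *)
have B1 : normc (cint 0 (pi *+ 2) (fun y => F (ln r +i* y))) <=
    2 * ((2 * B / r) * (pi *+ 2 - 0)).
  apply: (normc_cint_le pi20); first exact: bv.
  move=> y _; have En : normc (cexp (ln r +i* y)) = r.
    by rewrite normc_cexp [Rez _]/(ln r) lnK.
  rewrite /F; move: (cexp _) En => E En.
  rewrite /k (addrC w) addrK normcM normcV En ler_pM2r; last by rewrite invr_gt0.
  apply: (le_trans (normcB _ _)); rewrite mulr_natl mulr2n.
  apply: lerD; apply: hB; last exact: ww.
  by rewrite addrK En.
have B2 : normc (cint 0 (pi *+ 2) (fun y => F (ln m +i* y) - d)) <=
    2 * ((e / 2) * (pi *+ 2 - 0)).
  apply: (normc_cint_le pi20).
    by apply: cbmeasB; [exact: bv|exact: cbmeas_cst].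
  move=> y _; have En : normc (cexp (ln m +i* y)) = m.
    by rewrite normc_cexp [Rez _]/(ln m) lnK.
  rewrite /F; move: (cexp _) En => E En.
  have E0 : E != 0 by rewrite -normc_gt0 En.
  have := hd (w + E); rewrite /k (addrC w) addrK En => /(_ md) hh.
  have -> : (h (E + w) - h w) / E - d = (h (E + w) - h w - d * E) / E.
    by rewrite [RHS]mulrBl mulfK.
  by rewrite normcM normcV En ler_pdivrMr.
have := B2; rewrite cintB; [|exact: bv|exact: cbmeas_cst].
rewrite (cint_cst _ pi20) -cE => B2'.
have : normc (d * (pi *+ 2 - 0)%:C) <= 2 * ((2 * B / r) * (pi *+ 2 - 0)) +
                                   2 * ((e / 2) * (pi *+ 2 - 0)).
  have := lerD B1 B2'; apply: le_trans.
  set cI := cint _ _ _; set dI := d * _.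
  by have := normcB cI (cI - dI); rewrite opprB addrC subrK.
have pi2 : 0 < pi *+ 2 :> R by rewrite pmulrn_lgt0 ?pi_gt0.
rewrite normcM normc_real subr0 (ger0_norm pi20) !mulrA -mulrDl (ler_pM2r pi2).
move=> /le_trans; apply.
by apply: eq_ler; field; rewrite gt_eqF.
Qed.

(** Discs of radius [r] centred on the segment from [w] to [z] stay in the disc of radius [2 * r],
    so the derivative along the segment is at most 4 B / r. The mean value theorem is a real
    statement; applying it to each component doubles the constant. *)
Lemma cauchy_lipschitz (h : R[i] -> R[i]) (w : R[i]) (r B : R) : 0 < r ->
    (forall z, normc (z - w) <= 2 * r -> cdiff h z) ->
    (forall z, normc (z - w) <= 2 * r -> normc (h z) <= B) ->
  forall z, normc (z - w) <= r -> normc (h z - h w) <= 8 * B / r * normc (z - w).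
Proof.
move=> r0 dh hB z zr.
pose u := z - w; pose p (t : R) := w + t%:C * u.
have pw t : 0 <= t -> t <= 1 -> normc (p t - w) <= r.
  move=> t0 t1; rewrite /p (addrC w) addrK normcM normc_real ger0_norm//.
  by rewrite (le_trans _ zr)// ler_piMl// normc_ge0.
have est t : 0 <= t -> t <= 1 -> exists2 d : R[i], normc d <= 4 * B / r &
    forall e : R, 0 < e -> exists2 delta : R, 0 < delta &
    forall w', normc (w' - p t) < delta ->
      normc (h w' - h (p t) - d * (w' - p t)) <= e * normc (w' - p t).
  move=> t0 t1.
  have sub z' : normc (z' - p t) <= r -> normc (z' - w) <= 2 * r.
    move=> zp; have -> : z' - w = (z' - p t) + (p t - w) by rewrite addrA subrK.
    by rewrite (le_trans (normcD _ _))// mulr_natl mulr2n lerD// pw.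
  by apply: cauchy_estimate => // z' /sub; [exact: dh|exact: hB].
have [D DP] : exists D : R -> R[i], forall t, 0 <= t -> t <= 1 ->
    normc (D t) <= 4 * B / r /\ forall e : R, 0 < e -> exists2 delta : R, 0 < delta &
    forall w', normc (w' - p t) < delta ->
      normc (h w' - h (p t) - D t * (w' - p t)) <= e * normc (w' - p t).
  have : forall t, exists d, 0 <= t -> t <= 1 ->
    normc d <= 4 * B / r /\ forall e : R, 0 < e -> exists2 delta : R, 0 < delta &
    forall w', normc (w' - p t) < delta ->
      normc (h w' - h (p t) - d * (w' - p t)) <= e * normc (w' - p t).
    move=> t; have [t0|] := boolP (0 <= t); last by exists 0.
    have [t1|] := boolP (t <= 1); last by exists 0.
    by have [d d1 d2] := est t t0 t1; exists d.
  by move=> /choice[D DP]; exists D.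
have approx t : 0 <= t -> t <= 1 -> forall e : R, 0 < e -> exists2 delta : R, 0 < delta &
    forall s, `|s| < delta ->
      normc (h (p (t + s)) - h (p t) - D t * u * s%:C) <= e * `|s|.
  move=> t0 t1 e e0; have [_ hD] := DP t t0 t1.
  have u1 : 0 < normc u + 1 by rewrite ltr_wpDl// normc_ge0.
  have [delta delta0 hd] := hD (e / (normc u + 1)) (divr_gt0 e0 u1).
  exists (delta / (normc u + 1)) => [|s]; first exact: divr_gt0.
  rewrite ltr_pdivlMr// => sd.
  have pE : p (t + s) - p t = s%:C * u by rewrite /p rmorphD /=; ring.
  have := hd (p (t + s)); rewrite pE normcM normc_real.
  have su : `|s| * normc u < delta.
    by apply: le_lt_trans sd; rewrite ler_wpM2l// lerDl.
  move=> /(_ su) hh; have -> : D t * u * s%:C = D t * (s%:C * u) by ring.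
  rewrite (le_trans hh)// mulrAC ler_pdivrMr//.
  rewrite -mulrA ler_pM2l//.
  by rewrite ler_wpM2l// lerDl.
(* [g] stands for [Rez] or [Imz]. *)
have main (g : R[i] -> R) : (forall x y, g (x - y) = g x - g y) ->
    (forall x, `|g x| <= normc x) -> (forall x (s : R), g (x * s%:C) = g x * s) ->
    `|g (h z - h w)| <= 4 * B / r * normc u.
  move=> gB gN gZ.
  have is_d (t : R) : 0 <= t -> t <= 1 -> is_derive t 1 (fun s => g (h (p s))) (g (D t * u)).
    move=> t0 t1; apply: approx_is_derive => e e0.
    have [delta d0 dd] := approx t t0 t1 e e0; exists delta => // s sd.
    by rewrite -gZ -!gB (le_trans (gN _))// dd.
  have [|||c c01] := @MVT_segment _ (fun s => g (h (p s))) (fun t => g (D t * u)) 0 1.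
  - exact: ler01.
  - by move=> t; rewrite in_itv/= => /andP[t0 t1]; apply: is_d; exact: ltW.
  - apply: derivable_within_continuous => t; rewrite in_itv/= => /andP[t0 t1].
    by have [] := is_d t t0 t1.
  rewrite subr0 mulr1 /p mul0r addr0 mul1r /u (addrC w) subrK -gB => ->.
  rewrite (le_trans (gN _))// normcM ler_wpM2r ?normc_ge0//.
  by move: c01; rewrite in_itv/= => /andP[c0 c1]; have [] := DP c c0 c1.
rewrite (le_trans (normc_le_ReIm _))//.
have -> : 8 * B / r * normc (z - w) = 4 * B / r * normc u + 4 * B / r * normc u.
  by rewrite /u; ring.
rewrite lerD//; apply: main.
- exact: RezB.
- exact: Re_le_normc.
- by move=> x s; rewrite RezM /= mulr0 subr0.
- exact: ImzB.
- exact: Im_le_normc.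
- by move=> x s; rewrite ImzM /= mulr0 add0r.
Qed.

End Cauchy_estimate.

(** * Fields in the slab: energy, a priori bound and Wronskian *)

Lemma conjcD (R : realType) (x y : R[i]) : conjc (x + y) = conjc x + conjc y.
Proof. exact: rmorphD. Qed.

Lemma conjcM (R : realType) (x y : R[i]) : conjc (x * y) = conjc x * conjc y.
Proof. exact: rmorphM. Qed.

Section Fields.
Context {R : realType}.
Implicit Types (a z : R) (A v p : R -> R[i]) (g : R[i]).

(* [(v, p)] solves v' = A1 p, p' = A2 v on [0, a]; for the slab A1 = i w C' and
   A2 = i w rho'. *)
Record field a A1 A2 v p : Prop := Field {
  field_v : cbmeas 0 a v;
  field_p : cbmeas 0 a p;
  field_vE : forall x, x \in `[0, a] -> v x = v 0 + cint 0 x (fun t => A1 t * p t);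
  field_pE : forall x, x \in `[0, a] -> p x = p 0 + cint 0 x (fun t => A2 t * v t)
}.

(* A field with the soft backing p(a) = 0, normalized by p(0) = g = 1 + r and
   v(0) = (1 - r) / z, where r is the reflection coefficient. *)
Record backed_field a z A1 A2 v p g : Prop := BackedField {
  backed_is_field : field a A1 A2 v p;
  backed_v0 : v 0 = (2 - g) / z%:C;
  backed_p0 : p 0 = g;
  backed_pa : p a = 0
}.

Lemma itv_le_end a x : x \in `[0, a] -> 0 <= x /\ x <= a.
Proof. by rewrite in_itv/= => /andP. Qed.

Lemma field_linear a A1 A2 v p v' p' (s t : R[i]) :
    cbmeas 0 a A1 -> cbmeas 0 a A2 ->
    field a A1 A2 v p -> field a A1 A2 v' p' ->
  field a A1 A2 (fun x => v x * s + v' x * t) (fun x => p x * s + p' x * t).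
Proof.
move=> b1 b2 [bv bp vE pE] [bv' bp' vE' pE'].
have lin (h h' : R -> R[i]) : cbmeas 0 a h -> cbmeas 0 a h' ->
    cbmeas 0 a (fun x => h x * s + h' x * t).
  by move=> bh bh'; apply: cbmeasD; apply: cbmeasM => //; apply: cbmeas_cst.
have lini A h h' x : x \in `[0, a] -> cbmeas 0 a A -> cbmeas 0 a h -> cbmeas 0 a h' ->
    cint 0 x (fun y => A y * (h y * s + h' y * t)) =
    cint 0 x (fun y => A y * h y) * s + cint 0 x (fun y => A y * h' y) * t.
  move=> /itv_le_end[x0 xa] bA bh bh'.
  have sub k : cbmeas 0 a k -> cbmeas 0 x k by apply: cbmeas_sub.
  rewrite ![_ * s]mulrC ![_ * t]mulrC -!cintZ; try by apply: cbmeasM; apply: sub.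
  rewrite -cintD; try by apply: cbmeasZ; apply: cbmeasM; apply: sub.
  by apply: eq_cint => y _; ring.
split; try exact: lin.
- by move=> x xa; rewrite (vE _ xa) (vE' _ xa) lini//; ring.
- by move=> x xa; rewrite (pE _ xa) (pE' _ xa) lini//; ring.
Qed.

Lemma field_conj a A1 A2 v p : cbmeas 0 a A1 -> cbmeas 0 a A2 ->
    field a A1 A2 v p ->
  field a (fun x => conjc (A1 x)) (fun x => conjc (A2 x))
          (fun x => conjc (v x)) (fun x => conjc (p x)).
Proof.
move=> b1 b2 [bv bp vE pE]; split; try exact: cbmeas_conj.
- move=> x xa; have [x0 xle] := itv_le_end xa; rewrite (vE _ xa) conjcD; congr (_ + _).
  rewrite -cint_conj; last by apply: cbmeasM; apply: cbmeas_sub xle _.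
  by apply: eq_cint => t _; rewrite conjcM.
- move=> x xa; have [x0 xle] := itv_le_end xa; rewrite (pE _ xa) conjcD; congr (_ + _).
  rewrite -cint_conj; last by apply: cbmeasM; apply: cbmeas_sub xle _.
  by apply: eq_cint => t _; rewrite conjcM.
Qed.

(* The energy flux Re(p^* v) decreases into the slab. *)
Lemma field_energy a A1 A2 v p : 0 <= a -> cbmeas 0 a A1 -> cbmeas 0 a A2 ->
    (forall x, x \in `[0, a] -> Rez (A1 x) <= 0) ->
    (forall x, x \in `[0, a] -> Rez (A2 x) <= 0) ->
    field a A1 A2 v p ->
  Rez (conjc (p a) * v a) <= Rez (conjc (p 0) * v 0).
Proof.
move=> a0 b1 b2 A1le A2le F; have [bv bp vE pE] := F.
have [_ _ _ pcE] := field_conj b1 b2 F.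
have bA1p : cbmeas 0 a (fun t => A1 t * p t) by apply: cbmeasM.
have bA2v : cbmeas 0 a (fun t => conjc (A2 t) * conjc (v t)).
  by apply: cbmeasM; apply: cbmeas_conj.
have bpc := cbmeas_conj bp.
rewrite (cint_product_rule a0 bA2v bA1p bpc bv pcE vE) RezD gerDl Re_cint.
rewrite -oppr_ge0 -rintN; last first.
  by have [] : cbmeas 0 a (fun t => conjc (A2 t) * conjc (v t) * v t +
    conjc (p t) * (A1 t * p t)) by apply: cbmeasD; apply: cbmeasM.
apply: rint_ge0 => x xa; rewrite oppr_ge0.
(* The density of the flux is Re A2 |v|^2 + Re A1 |p|^2, so only the signs of the two real parts
   enter. *)
have -> : Rez (conjc (A2 x) * conjc (v x) * v x + conjc (p x) * (A1 x * p x)) =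
   Rez (A2 x) * (Rez (v x) ^+ 2 + Imz (v x) ^+ 2) +
   Rez (A1 x) * (Rez (p x) ^+ 2 + Imz (p x) ^+ 2).
  by rewrite !(RezD, ImzD, RezM, ImzM, Rez_conj, Imz_conj); ring.
by rewrite -[leRHS]addr0 lerD// mulr_le0_ge0 ?A1le ?A2le ?addr_ge0 ?sqr_ge0.
Qed.

(** Gronwall's inequality for the sum of the two moduli. The sources are zero for the a priori
    bound; when two frequencies are compared they hold coefficient increments times a field. The
    extra 2 in the exponent is that of [normc_cint]. *)
Lemma field_bound a A1 A2 v p s1 s2 (K v0 p0 : R) : 0 <= a -> 0 < K ->
    cbmeas 0 a A1 -> cbmeas 0 a A2 -> cbmeas 0 a v -> cbmeas 0 a p ->
    cbmeas 0 a s1 -> cbmeas 0 a s2 ->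
    (forall x, x \in `[0, a] -> normc (A1 x) <= K) ->
    (forall x, x \in `[0, a] -> normc (A2 x) <= K) ->
    normc (v 0) <= v0 -> normc (p 0) <= p0 ->
    (forall x, x \in `[0, a] -> v x = v 0 + cint 0 x (fun t => A1 t * p t + s1 t)) ->
    (forall x, x \in `[0, a] -> p x = p 0 + cint 0 x (fun t => A2 t * v t + s2 t)) ->
  forall x, x \in `[0, a] -> normc (v x) + normc (p x) <=
    2 * (v0 + p0 + 2 * rint 0 a (fun t => normc (s1 t) + normc (s2 t))) *
    expR (2 * (2 * K) * a).
Proof.
move=> a0 K0 b1 b2 bv bp bs1 bs2 A1K A2K hv0 hp0 vE pE.
have bnv := bmeas_normc bv; have bnp := bmeas_normc bp.
have bn1 := bmeas_normc bs1; have bn2 := bmeas_normc bs2.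
have v00 : 0 <= v0 := le_trans (normc_ge0 _) hv0.
have p00 : 0 <= p0 := le_trans (normc_ge0 _) hp0.
have bS := bmeasD bn1 bn2; have bY := bmeasD bnv bnp.
have S0 : 0 <= rint 0 a (fun t => normc (s1 t) + normc (s2 t)).
  by apply: rint_ge0 => x _; rewrite addr_ge0 ?normc_ge0.
apply: gronwall => //.
- by rewrite mulr_gt0.
- by rewrite !addr_ge0// mulr_ge0.
- by move=> x _; rewrite addr_ge0 ?normc_ge0.
move=> x xa; have [x0 xle] := itv_le_end xa.
have sub k : bmeas 0 a k -> bmeas 0 x k by apply: bmeas_sub.
have csub k : cbmeas 0 a k -> cbmeas 0 x k by apply: cbmeas_sub.
have inx t : t \in `[0, x] -> t \in `[0, a] by apply: subitv.
have Sx : rint 0 x (fun t => normc (s1 t) + normc (s2 t)) <=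
          rint 0 a (fun t => normc (s1 t) + normc (s2 t)).
  rewrite (rint_cat x0 xle bS) lerDl; apply: rint_ge0 => t _.
  by rewrite addr_ge0 ?normc_ge0.
have bKp : bmeas 0 x (fun t => K * normc (p t) + normc (s1 t)).
  by apply: sub; apply: bmeasD => //; apply: bmeasM => //; apply: bmeas_cst.
have bKv : bmeas 0 x (fun t => K * normc (v t) + normc (s2 t)).
  by apply: sub; apply: bmeasD => //; apply: bmeasM => //; apply: bmeas_cst.
have i1 : normc (cint 0 x (fun t => A1 t * p t + s1 t)) <=
    2 * rint 0 x (fun t => K * normc (p t) + normc (s1 t)).
  apply: normc_cint => //; first by apply: csub; apply: cbmeasD => //; apply: cbmeasM.
  move=> t /inx ta; apply: (le_trans (normcD _ _)); rewrite lerD2r normcM.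
  by rewrite ler_wpM2r ?normc_ge0 ?A1K.
have i2 : normc (cint 0 x (fun t => A2 t * v t + s2 t)) <=
    2 * rint 0 x (fun t => K * normc (v t) + normc (s2 t)).
  apply: normc_cint => //; first by apply: csub; apply: cbmeasD => //; apply: cbmeasM.
  move=> t /inx ta; apply: (le_trans (normcD _ _)); rewrite lerD2r normcM.
  by rewrite ler_wpM2r ?normc_ge0 ?A2K.
have iE : rint 0 x (fun t => K * normc (p t) + normc (s1 t)) +
          rint 0 x (fun t => K * normc (v t) + normc (s2 t)) =
    K * rint 0 x (fun t => normc (v t) + normc (p t)) +
    rint 0 x (fun t => normc (s1 t) + normc (s2 t)).
  have bKY := bmeasM (bmeas_cst 0 x K) (sub _ bY).
  rewrite -(rintD bKp bKv) -(rintZ K (sub _ bY)) -(rintD bKY (sub _ bS)).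
  by apply: eq_rint => t _; ring.
rewrite (vE _ xa) (pE _ xa).
apply: (le_trans (lerD (normcD _ _) (normcD _ _))).
apply: (le_trans (lerD (lerD hv0 i1) (lerD hp0 i2))).
rewrite addrACA -mulrDr iE; move: Sx.
set s := rint 0 x (fun t => normc (s1 t) + _); set s' := rint 0 a _ => ss'.
set y := rint 0 x _; have -> : v0 + p0 + 2 * (K * y + s) = v0 + p0 + 2 * s + 2 * K * y by ring.
by rewrite lerD2r lerD2l ler_pM2l.
Qed.

(* The Wronskian of two backed fields vanishes at [a]; at [0] it is
   proportional to the difference of their normalizations. *)
Lemma backed_field_diff a z A1 A2 v p g A1' A2' v' p' g' : 0 <= a -> 0 < z ->
    cbmeas 0 a A1 -> cbmeas 0 a A2 -> cbmeas 0 a A1' -> cbmeas 0 a A2' ->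
    backed_field a z A1 A2 v p g -> backed_field a z A1' A2' v' p' g' ->
  g' - g = - (z / 2)%:C * cint 0 a (fun t =>
    (A2' t - A2 t) * (v t * v' t) - (A1' t - A1 t) * (p t * p' t)).
Proof.
move=> a0 z0 b1 b2 b1' b2' [[bv bp vE pE] v0 p0 pa] [[bv' bp' vE' pE'] v0' p0' pa'].
have := cint_product_rule a0 (cbmeasM b1 bp) (cbmeasM b2' bv') bv bp' vE pE'.
have := cint_product_rule a0 (cbmeasM b2 bv) (cbmeasM b1' bp') bp bv' pE vE'.
(* The products g g' cancel between the two boundary terms, so that I2 - I1 = - 2 (g' - g) / z. *)
rewrite pa pa' mul0r mulr0 p0 p0' v0 v0'.
set I1 := cint 0 a _; set I2 := cint 0 a _ => h1 h2.
have -> : cint 0 a (fun t => (A2' t - A2 t) * (v t * v' t) -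
    (A1' t - A1 t) * (p t * p' t)) = I2 - I1.
  rewrite -cintB; last 2 first.
  - by apply: cbmeasD; do 2 apply: cbmeasM => //.
  - by apply: cbmeasD; do 2 apply: cbmeasM => //.
  by apply: eq_cint => t _; ring.
have zC : z%:C != 0 by rewrite fmorph_eq0 gt_eqF.
have -> : I2 = - ((2 - g) / z%:C * g') by apply/eqP; rewrite -addr_eq0 addrC -h2.
have -> : I1 = - (g * ((2 - g') / z%:C)) by apply/eqP; rewrite -addr_eq0 addrC -h1.
rewrite rmorphM fmorphV /= (_ : 2%:R%:C = 2)%R; last by rewrite rmorph_nat.
by field; rewrite zC.
Qed.

End Fields.

(** * The surface pressure of the slab as a function of the frequency *)

Lemma quotient_cdiff (R : realType) (F : R[i] -> R[i]) (w L : R[i]) :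
    (forall e : R, 0 < e -> exists2 d : R, 0 < d & forall w', w' != w ->
       normc (w' - w) < d -> normc ((F w' - F w) / (w' - w) - L) < e) ->
  cdiff F w.
Proof.
move=> H; exists (fun w' => if w' == w then L else (F w' - F w) / (w' - w)); last first.
  move=> w'; case: eqP => [->|/eqP ww]; first by rewrite subrr mulr0 addr0.
  by rewrite divfK ?subr_eq0// addrC subrK.
move=> e e0; rewrite eqxx; have [d d0 dP] := H e e0.
exists d => // x xw; case: eqP => [_|/eqP xn].
  by rewrite (subrr (L : R[i])) normc0.
exact: dP.
Qed.

Section Slab.
Context {R : realType} (a z : R) (rho' C' : R -> R[i] -> R[i])
  (M : R -> R[i] -> 'M[R[i]]_2).
Hypotheses (a_gt0 : 0 < a) (z_gt0 : 0 < z).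
Hypotheses (hr : slab_parameter a rho') (hC : slab_parameter a C').
Hypothesis hM : forall w : R[i], closed_upper_half w ->
  is_propagator a rho' C' w (fun x => M x w).
Implicit Types (q : R -> R[i] -> R[i]) (w : R[i]) (x t : R).

Let a_ge0 : 0 <= a. Proof. exact: ltW. Qed.

Definition coef q w x : R[i] := 'i%C * w * q x w.

Lemma slab_cbmeas q w : slab_parameter a q -> closed_upper_half w ->
  cbmeas 0 a (fun x => q x w).
Proof.
move=> hq cw; have [B qB] := slab_bounded hq.
apply: (@cbmeas_intro _ _ _ _ B).
- exact: (slab_measurable_Re hq cw).
- exact: (slab_measurable_Im hq cw).
- by move=> x xa; have := qB x w xa cw; rewrite normc_val lecR.
Qed.

Lemma slab_common_bound : exists2 B : R, 0 < B & forall w x,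
  closed_upper_half w -> x \in `[0, a] ->
  normc (rho' x w) <= B /\ normc (C' x w) <= B.
Proof.
have [B1 h1] := slab_bounded hr; have [B2 h2] := slab_bounded hC.
exists (`|B1| + `|B2| + 1) => [|w x cw xa]; first by rewrite ltr_wpDl// addr_ge0.
have := h1 x w xa cw; have := h2 x w xa cw; rewrite !normc_val !lecR => k2 k1.
split; [apply: (le_trans k1)|apply: (le_trans k2)].
  by rewrite -addrA (le_trans (ler_norm _))// lerDl addr_ge0.
by rewrite addrAC (le_trans (ler_norm _))// lerDr addr_ge0.
Qed.

Lemma coef_cbmeas q w : slab_parameter a q -> closed_upper_half w ->
  cbmeas 0 a (coef q w).
Proof. by move=> hq cw; apply: cbmeasZ; apply: slab_cbmeas. Qed.

Lemma normc_coef q w x : normc (coef q w x) = normc w * normc (q x w).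
Proof. by rewrite /coef !normcM normc_i mul1r. Qed.

Lemma coef_passive q w x : slab_parameter a q -> closed_upper_half w ->
  x \in `[0, a] -> Rez (coef q w x) <= 0.
Proof.
move=> hq cw xa; rewrite /coef -mulrA RezM /= mul0r mul1r sub0r oppr_le0.
exact: slab_passive hq x w xa cw.
Qed.

Lemma propagator0 w i j : closed_upper_half w ->
  M 0 w i j = (1%:M : 'M[R[i]]_2) i j.
Proof.
move=> cw; have [_ /(_ 0)] := hM cw i j; rewrite in_itv/= lexx a_ge0 => /(_ isT) ->.
by rewrite -/(cint 0 0 _) cint_point mulr0 addr0.
Qed.

Lemma propagator_column w j : closed_upper_half w ->
  field a (coef C' w) (coef rho' w) (fun x => M x w 0 j) (fun x => M x w 1 j).
Proof.
(* [big_ord_recl] names the second index [lift ord0 ord0]. *)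
move=> cw; have h01 : (lift ord0 ord0 : 'I_2) = 1 by apply/val_inj.
have bM i : cbmeas 0 a (fun x => M x w i j).
  by apply: cbmeas_continuous; case: (hM cw i j).
split; [exact: bM|exact: bM| |] => x xa; have [x0 xle] := itv_le_end xa.
- have [_ /(_ x xa) ->] := hM cw 0 j; rewrite (propagator0 _ _ cw) -/(cint 0 x _); congr (_ + _).
  rewrite -cintZ; last first.
    apply: (@eq_cbmeas _ _ _ (fun t => C' t w * M t w 1 j)).
      by move=> t _; rewrite mxE !big_ord_recl big_ord0 !mxE/= h01 mul0r add0r addr0.
    by apply: cbmeasM; apply: cbmeas_sub xle _ => //; do [exact: slab_cbmeas|exact: bM].
  apply: eq_cint => t _; rewrite mxE !big_ord_recl big_ord0 !mxE/= h01.
  by rewrite mul0r add0r addr0 /coef !mulrA.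
- have [_ /(_ x xa) ->] := hM cw 1 j; rewrite (propagator0 _ _ cw) -/(cint 0 x _); congr (_ + _).
  rewrite -cintZ; last first.
    apply: (@eq_cbmeas _ _ _ (fun t => rho' t w * M t w 0 j)).
      by move=> t _; rewrite mxE !big_ord_recl big_ord0 !mxE/= h01 mul0r addr0 addr0.
    by apply: cbmeasM; apply: cbmeas_sub xle _ => //; do [exact: slab_cbmeas|exact: bM].
  apply: eq_cint => t _; rewrite mxE !big_ord_recl big_ord0 !mxE/= h01.
  by rewrite mul0r addr0 addr0 /coef !mulrA.
Qed.

Definition vcomb w (s t : R[i]) x := M x w 0 0 * s + M x w 0 1 * t.
Definition pcomb w (s t : R[i]) x := M x w 1 0 * s + M x w 1 1 * t.

Lemma comb_field w (s t : R[i]) : closed_upper_half w ->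
  field a (coef C' w) (coef rho' w) (vcomb w s t) (pcomb w s t).
Proof.
move=> cw; apply: field_linear; [exact: coef_cbmeas..|exact: propagator_column|].
exact: propagator_column.
Qed.

Lemma vcomb0 w (s t : R[i]) : closed_upper_half w -> vcomb w s t 0 = s.
Proof.
by move=> cw; rewrite /vcomb !propagator0// !mxE/= mul1r mul0r addr0.
Qed.

Lemma pcomb0 w (s t : R[i]) : closed_upper_half w -> pcomb w s t 0 = t.
Proof.
by move=> cw; rewrite /pcomb !propagator0// !mxE/= mul1r mul0r add0r.
Qed.

(** The flux vanishes at the soft backing and decreases into the slab. *)
Lemma comb_energy w (s t : R[i]) : closed_upper_half w -> pcomb w s t a = 0 ->
  0 <= Rez (conjc t * s).
Proof.
move=> cw pa; have b1 := coef_cbmeas hC cw; have b2 := coef_cbmeas hr cw.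
have := field_energy a_ge0 b1 b2 _ _ (comb_field s t cw).
rewrite pa vcomb0// pcomb0// conjc0 mul0r; apply.
- by move=> x; apply: coef_passive.
- by move=> x; apply: coef_passive.
Qed.

(** A zero would make the field with v(0) = -1 and p(0) = z satisfy p(a) = 0, although its flux at
    the front is - z < 0. *)
Lemma denominator_neq0 w : closed_upper_half w ->
  z%:C * M a w 1 1 - M a w 1 0 != 0.
Proof.
move=> cw; apply/eqP => D0; have := @comb_energy w (-1) z%:C cw.
rewrite /pcomb mulrN mulr1 addrC [_ * z%:C]mulrC => /(_ D0).
by rewrite conjc_real mulrN mulr1 /= oppr_ge0 leNgt z_gt0.
Qed.

Definition psurf w : R[i] := 1 + soft_reflection z (M a w).
Definition vf w := vcomb w ((2 - psurf w) / z%:C) (psurf w).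
Definition pf w := pcomb w ((2 - psurf w) / z%:C) (psurf w).

Let zC0 : z%:C != 0. Proof. by rewrite fmorph_eq0 gt_eqF. Qed.

Lemma slab_backed w : closed_upper_half w ->
  backed_field a z (coef C' w) (coef rho' w) (vf w) (pf w) (psurf w).
Proof.
move=> cw; split.
- exact: comb_field.
- exact: vcomb0.
- exact: pcomb0.
have z0 : z != 0 by rewrite gt_eqF.
have := (soft_reflectionP (soft_reflection z (M a w)) z0 (denominator_neq0 cw)).2 erefl.
by rewrite /pf /pcomb /psurf opprD addrA (_ : 2 - 1 = 1)//; ring.
Qed.

(** For p(0) = 1 + r and v(0) = (1 - r) / z the entering flux is (1 - |r|^2) / z. *)
Lemma reflection_le1 w : closed_upper_half w ->
  normc (soft_reflection z (M a w)) <= 1.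
Proof.
move=> cw; have := comb_energy cw (backed_pa (slab_backed cw)); rewrite /psurf.
move: (soft_reflection _ _) => r.
have -> : 2 - (1 + r) = 1 - r by ring.
have -> : Rez (conjc (1 + r) * ((1 - r) / z%:C)) = (1 - normc r ^+ 2) / z.
  rewrite mulrA -fmorphV RezM /= mulr0 subr0; congr (_ / z).
  by rewrite normc_sqr !(RezM, RezB, RezD, ImzB, ImzD, Rez_conj, Imz_conj) /=; ring.
rewrite pmulr_lge0 ?invr_gt0// subr_ge0 => h.
by rewrite -(@ler_pXn2r _ 2) ?nnegrE ?normc_ge0// expr1n.
Qed.

Lemma normc_psurf w : closed_upper_half w -> normc (psurf w) <= 2.
Proof.
move=> cw; apply: (le_trans (normcD _ _)); rewrite normc1.
by rewrite (_ : 2 = 1 + 1)// lerD2l reflection_le1.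
Qed.

Lemma Re_psurf_ge0 w : closed_upper_half w -> 0 <= Rez (psurf w).
Proof.
move=> cw; rewrite /psurf RezD /= -lerBlDl sub0r lerNl.
rewrite (le_trans _ (reflection_le1 cw))// (le_trans _ (Re_le_normc _))//.
by rewrite -normrN ler_norm.
Qed.

(** Since |psurf| <= 2, the data at x = 0 are bounded for all frequencies at once, and the frequency
    enters the exponent only through [L]. *)
Lemma fields_uniform_bound (L : R) : 0 < L -> exists2 V : R, 0 < V &
  forall w x, closed_upper_half w -> normc w <= L -> x \in `[0, a] ->
  normc (vf w x) <= V /\ normc (pf w x) <= V.
Proof.
move=> L0; have [B B0 hB] := slab_common_bound.
(* [field_bound] with |v(0)| <= 4 / z, |p(0)| <= 2 and zero sources. *)
pose V := 2 * (4 / z + 2 + 2 * 0) * expR (2 * (2 * (L * B)) * a).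
exists V => [|w x cw wL xa].
  by rewrite mulr_gt0 ?expR_gt0// mulr_gt0// mulr0 addr0 addr_gt0// divr_gt0.
have [[bv bp vE pE] v0 p0 _] := slab_backed cw.
have bz : cbmeas 0 a (fun=> 0 : R[i]) := cbmeas_cst _ _ _.
have h := @field_bound _ a (coef C' w) (coef rho' w) (vf w) (pf w) (fun=> 0) (fun=> 0)
  (L * B) (4 / z) 2 a_ge0 (mulr_gt0 L0 B0) (coef_cbmeas hC cw) (coef_cbmeas hr cw)
  bv bp bz bz.
have {h} : normc (vf w x) + normc (pf w x) <= V.
  have e0 : rint 0 a (fun=> normc (0 : R[i]) + normc (0 : R[i])) = 0.
    by rewrite rint_cst// normc0 addr0 mul0r.
  rewrite e0 in h; apply: h => //.
  - move=> t ta; rewrite normc_coef ler_pM ?normc_ge0//.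
    by have [] := hB w t cw ta.
  - move=> t ta; rewrite normc_coef ler_pM ?normc_ge0//.
    by have [] := hB w t cw ta.
  - rewrite v0 normcM normcV normc_real (ger0_norm (ltW z_gt0)) ler_pM2r ?invr_gt0//.
    have c2 : (2 : R[i]) = (2 : R)%:C by rewrite rmorph_nat.
    have n2 : normc (2 : R[i]) = 2 by rewrite c2 normc_real ger0_norm.
    by rewrite (le_trans (normcB _ _))// n2 (_ : 4 = 2 + 2) ?lerD2l ?normc_psurf// -natrD.
  - by rewrite p0 normc_psurf.
  - by move=> t ta; rewrite (vE _ ta); congr (_ + _); apply: eq_cint => s _; rewrite addr0.
  - by move=> t ta; rewrite (pE _ ta); congr (_ + _); apply: eq_cint => s _; rewrite addr0.
by move=> h; split; apply: le_trans h; rewrite ?lerDl ?lerDr normc_ge0.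
Qed.

(** An L^1 distance in x: the parameters are continuous in w for each x without any uniformity, and
    dominated convergence makes this distance small, whereas a supremum over x need not be. *)
Definition osc w w' : R := rint 0 a (fun x =>
  normc (coef C' w' x - coef C' w x) + normc (coef rho' w' x - coef rho' w x)).

Lemma osc_bmeas w w' : closed_upper_half w -> closed_upper_half w' ->
  bmeas 0 a (fun x =>
    normc (coef C' w' x - coef C' w x) + normc (coef rho' w' x - coef rho' w x)).
Proof.
by move=> cw cw'; apply: bmeasD; apply: bmeas_normc; apply: cbmeasB; apply: coef_cbmeas.
Qed.

Lemma osc_ge0 w w' : 0 <= osc w w'.
Proof. by apply: rint_ge0 => x _; rewrite addr_ge0 ?normc_ge0. Qed.

Lemma coef_cvg q w x : slab_parameter a q -> closed_upper_half w -> x \in `[0, a] ->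
  (fun w' => coef q w' x) @ within closed_upper_half (nbhs w) --> coef q w x.
Proof.
move=> hq cw xa; have FF : Filter (within closed_upper_half (nbhs w)).
  exact: within_filter.
apply: (complex_cvgM (FF := FF)); last first.
  by have /subspace_continuousP/(_ w cw) := slab_continuous hq xa.
apply: (complex_cvgM (FF := FF)).
  by apply/cvg_within_normcP => e e0; exists 1 => // ? _ _; rewrite subrr normc0.
by apply/cvg_within_normcP => e e0; exists e.
Qed.

Lemma osc_cvg w : closed_upper_half w -> forall e : R, 0 < e ->
  exists2 d : R, 0 < d & forall w', closed_upper_half w' -> normc (w' - w) < d ->
    osc w w' < e.
Proof.
move=> cw e e0; have [B B0 hB] := slab_common_bound.
have FF : Filter (within closed_upper_half (nbhs w)) by exact: within_filter.
(* The real integrand is embedded in R[i] so that [cint_param_cvg] applies. *)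
pose phi w' x : R[i] :=
  (normc (coef C' w' x - coef C' w x) + normc (coef rho' w' x - coef rho' w x))%:C.
have : (fun w' => cint 0 a (phi w')) @ within closed_upper_half (nbhs w) -->
       cint 0 a (fun=> 0).
  have nb q w' x (B' : R) : normc (q x w') <= B -> normc (q x w) <= B ->
      normc (w' - w) < 1 ->
      normc (coef q w' x - coef q w x) <= (normc w + 1) * B + normc w * B.
    move=> h1 h2 ww; apply: (le_trans (normcB _ _)); rewrite !normc_coef lerD//.
      apply: ler_pM; rewrite ?normc_ge0// -(subrK w w') (le_trans (normcD _ _))//.
      by rewrite addrC lerD2l ltW.
    by rewrite ler_wpM2l ?normc_ge0.
  pose B2 := (normc w + 1) * B + normc w * B.
  apply: (@cint_param_cvg _ 0 a closed_upper_half w phi (fun=> 0) (B2 + B2) 1) => //.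
  - by move=> w' cw' _; apply: cbmeas_real; exact: osc_bmeas.
  - move=> w' x cw' ww xa; rewrite normc_real ger0_norm ?addr_ge0 ?normc_ge0//.
    have [r1 c1] := hB w' x cw' xa; have [r2 c2] := hB w x cw xa.
    by rewrite lerD// nb.
  - move=> x xa; apply/cvg_within_normcP => e1 e10.
    have e2 : 0 < e1 / 2 by rewrite divr_gt0.
    have [d1 d10 h1] := (cvg_within_normcP _ _ _ _).1 (coef_cvg hC cw xa) _ e2.
    have [d2 d20 h2] := (cvg_within_normcP _ _ _ _).1 (coef_cvg hr cw xa) _ e2.
    exists (Num.min d1 d2) => [|w' cw']; first by rewrite lt_min d10.
    rewrite lt_min => /andP[wd1 wd2]; rewrite subr0 normc_real.
    rewrite ger0_norm ?addr_ge0 ?normc_ge0// [ltRHS]splitr ltrD//.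
      exact: h1.
    exact: h2.
move=> /cvg_within_normcP/(_ e e0)[d d0 dP]; exists d => // w' cw' /dP-/(_ cw').
rewrite cint_real cint_cst// mul0r subr0 normc_real ger0_norm//.
exact: osc_ge0.
Qed.

(** The Wronskian bounds the increment of psurf by [osc], hence also the increments of v(0) and
    p(0); Gronwall's inequality then carries the bound across the slab. *)
Lemma fields_stability w : closed_upper_half w -> exists2 K : R, 0 < K &
  forall w', closed_upper_half w' -> normc (w' - w) < 1 ->
    normc (psurf w' - psurf w) <= K * osc w w' /\ forall x, x \in `[0, a] ->
    normc (vf w' x - vf w x) <= K * osc w w' /\
    normc (pf w' x - pf w x) <= K * osc w w'.
Proof.
move=> cw; have [B B0 hB] := slab_common_bound.
pose L := normc w + 1; have L0 : 0 < L by rewrite ltr_wpDl ?normc_ge0.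
have [V V0 hV] := fields_uniform_bound L0.
have wL : normc w <= L by rewrite lerDl.
have zn : normc z%:C = z by rewrite normc_real ger0_norm// ltW.
pose KG := z / 2 * (2 * (V * V)); have KG0 : 0 < KG.
  by rewrite !mulr_gt0// divr_gt0.
pose E := expR (2 * (2 * (L * B)) * a); have E0 : 0 < E by exact: expR_gt0.
pose KF := 2 * (KG / z + KG + 2 * V) * E; have KF0 : 0 < KF.
  by rewrite mulr_gt0// mulr_gt0// !addr_gt0// ?divr_gt0// mulr_gt0.
exists (KG + KF) => [|w' cw' ww]; first exact: addr_gt0.
have wL' : normc w' <= L.
  by rewrite -(subrK w w') (le_trans (normcD _ _))// addrC lerD2l ltW.
have bk := slab_backed cw; have bk' := slab_backed cw'.
have [[bv bp vE pE] v0 p0 pa] := bk; have [[bv' bp' vE' pE'] v0' p0' pa'] := bk'.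
have b1 := coef_cbmeas hC cw; have b2 := coef_cbmeas hr cw.
have b1' := coef_cbmeas hC cw'; have b2' := coef_cbmeas hr cw'.
have O0 := osc_ge0 w w'; have bO := osc_bmeas cw cw'.
have hG : normc (psurf w' - psurf w) <= KG * osc w w'.
  rewrite (backed_field_diff a_ge0 z_gt0 b1 b2 b1' b2' bk bk').
  rewrite normcM normcN normc_real ger0_norm ?divr_ge0 ?(ltW z_gt0)//.
  rewrite /KG -!mulrA ler_pM2l ?z_gt0// ler_pM2l ?invr_gt0//.
  rewrite (mulrA V V) /osc -(rintZ _ bO); apply: normc_cint.
  - exact: (cbmeasB (cbmeasM (cbmeasB b2' b2) (cbmeasM bv bv'))
                    (cbmeasM (cbmeasB b1' b1) (cbmeasM bp bp'))).
  - by apply: bmeasM => //; exact: bmeas_cst.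
  move=> x xa; apply: (le_trans (normcB _ _)); rewrite !normcM mulrDr addrC.
  have [h1 h2] := hV w x cw wL xa; have [h1' h2'] := hV w' x cw' wL' xa.
  by rewrite lerD// mulrC ler_wpM2r ?normc_ge0// ler_pM ?normc_ge0.
have hF x : x \in `[0, a] -> normc (vf w' x - vf w x) + normc (pf w' x - pf w x) <=
    KF * osc w w'.
  (* The difference of the fields solves the system at [w] with sources [s1] and [s2]. *)
  pose s1 t := (coef C' w' t - coef C' w t) * pf w' t.
  pose s2 t := (coef rho' w' t - coef rho' w t) * vf w' t.
  have bs1 : cbmeas 0 a s1 by apply: cbmeasM => //; exact: cbmeasB.
  have bs2 : cbmeas 0 a s2 by apply: cbmeasM => //; exact: cbmeasB.
  have bdv := cbmeasB bv' bv; have bdp := cbmeasB bp' bp.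
  have h := @field_bound _ a (coef C' w) (coef rho' w) (fun x => vf w' x - vf w x)
    (fun x => pf w' x - pf w x) s1 s2 (L * B) (KG * osc w w' / z) (KG * osc w w')
    a_ge0 (mulr_gt0 L0 B0) b1 b2 bdv bdp bs1 bs2.
  move=> xa; apply: (le_trans (h _ _ _ _ _ _ x xa)).
  - move=> t ta; rewrite normc_coef ler_pM ?normc_ge0//.
    by have [] := hB w t cw ta.
  - move=> t ta; rewrite normc_coef ler_pM ?normc_ge0//.
    by have [] := hB w t cw ta.
  - rewrite v0 v0' -mulrBl normcM normcV zn ler_pM2r ?invr_gt0//.
    rewrite (_ : 2 - psurf w' - (2 - psurf w) = - (psurf w' - psurf w)); last by ring.
    by rewrite normcN.
  - by rewrite p0 p0'.
  - move=> t ta; have [t0 tle] := itv_le_end ta.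
    rewrite (vE _ ta) (vE' _ ta) opprD addrACA; congr (_ + _).
    rewrite -(cintB (cbmeas_sub (lexx 0) tle (cbmeasM b1' bp'))
                   (cbmeas_sub (lexx 0) tle (cbmeasM b1 bp))).
    by apply: eq_cint => s _; rewrite /s1; ring.
  - move=> t ta; have [t0 tle] := itv_le_end ta.
    rewrite (pE _ ta) (pE' _ ta) opprD addrACA; congr (_ + _).
    rewrite -(cintB (cbmeas_sub (lexx 0) tle (cbmeasM b2' bv'))
                   (cbmeas_sub (lexx 0) tle (cbmeasM b2 bv))).
    by apply: eq_cint => s _; rewrite /s2; ring.
  have iS : rint 0 a (fun t => normc (s1 t) + normc (s2 t)) <= V * osc w w'.
    rewrite /osc -(rintZ _ bO); apply: le_rint.
    - by apply: bmeasD; exact: bmeas_normc.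
    - by apply: bmeasM => //; exact: bmeas_cst.
    move=> t ta; have [h1' h2'] := hV w' t cw' wL' ta.
    by rewrite /s1 /s2 !normcM mulrDr lerD// mulrC ler_wpM2r ?normc_ge0.
  rewrite -/E /KF [leRHS]mulrAC ler_pM2r//.
  have two : 0 <= 2 :> R by [].
  rewrite -[X in _ <= X]mulrA; apply: (ler_wpM2l two).
  rewrite !mulrDl lerD//; first by rewrite [KG / z * _]mulrAC.
  by rewrite !mul1r lerD.
split=> [|x xa].
  by rewrite (le_trans hG)// ler_wpM2r// lerDl ltW.
have h : KF * osc w w' <= (KG + KF) * osc w w' by rewrite ler_wpM2r// lerDr ltW.
have := le_trans (hF x xa) h => {}h.
by split; apply: le_trans h; rewrite ?lerDl ?lerDr normc_ge0.
Qed.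

Lemma stable_cvg w (g : R[i] -> R[i]) (K : R) : closed_upper_half w -> 0 < K ->
    (forall w', closed_upper_half w' -> normc (w' - w) < 1 ->
       normc (g w' - g w) <= K * osc w w') ->
  g @ within closed_upper_half (nbhs w) --> g w.
Proof.
move=> cw K0 gK; apply/cvg_within_normcP => e e0.
have [d d0 dP] := osc_cvg cw (divr_gt0 e0 K0).
exists (Num.min d 1) => [|w' cw']; first by rewrite lt_min d0 ltr01.
rewrite lt_min => /andP[wd w1]; apply: (le_lt_trans (gK _ cw' w1)).
by rewrite mulrC -ltr_pdivlMr// dP.
Qed.

Lemma psurf_cvg w : closed_upper_half w ->
  psurf @ within closed_upper_half (nbhs w) --> psurf w.
Proof.
move=> cw; have [K K0 hK] := fields_stability cw.
by apply: (stable_cvg cw K0) => w' cw' ww; have [] := hK w' cw' ww.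
Qed.

Lemma coef_cdiff q w x : slab_parameter a q -> 0 < Imz w -> x \in `[0, a] ->
  cdiff (fun w' => coef q w' x) w.
Proof.
move=> hq w0 xa; apply: cdiffM; first by apply: cdiffM; [exact: cdiff_cst|exact: cdiff_id].
by apply: derivable_cdiff; exact: (slab_analytic hq xa w0).
Qed.

Lemma Im_near w w' : Imz w - normc (w' - w) <= Imz w'.
Proof.
have := Im_le_normc (w' - w); rewrite ImzB ler_norml => /andP[h _].
by move: h; lra.
Qed.

(** [L] is independent of x because it comes from the bound on [q], which is joint in x and w. This
    is what dominates the difference quotients. *)
Lemma coef_lipschitz q w : slab_parameter a q -> 0 < Imz w ->
  exists2 L : R, 0 < L & forall w' x, normc (w' - w) <= Imz w / 4 -> x \in `[0, a] ->
    normc (coef q w' x - coef q w x) <= L * normc (w' - w).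
Proof.
move=> hq w0; have [B0 hB] := slab_bounded hq.
pose B := `|B0| + 1; have B1 : 0 < B by rewrite ltr_wpDl.
(* The disc of radius [2 * r] then stays in the open upper half-plane. *)
pose r := Imz w / 4; have r0 : 0 < r by rewrite divr_gt0.
pose B' := (normc w + 2 * r) * B.
have B'0 : 0 < B' by rewrite mulr_gt0// ltr_wpDl ?normc_ge0// mulr_gt0.
exists (8 * B' / r) => [|w' x ww xa]; first by rewrite divr_gt0// mulr_gt0.
have r2 : 2 * r < Imz w by rewrite /r; lra.
have pos w1 : normc (w1 - w) <= 2 * r -> 0 < Imz w1.
  by move=> h; apply: lt_le_trans (Im_near w w1); rewrite subr_gt0 (le_lt_trans h).
apply: (@cauchy_lipschitz _ (fun w => coef q w x) w r B' r0) => // w1 hw1.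
  by apply: coef_cdiff => //; exact: pos.
rewrite normc_coef; apply: ler_pM; rewrite ?normc_ge0//.
  by rewrite -(subrK w w1) (le_trans (normcD _ _))// addrC lerD2l.
have cw1 : closed_upper_half w1 by rewrite /closed_upper_half/= ltW// pos.
have := hB x w1 xa cw1; rewrite normc_val lecR => /le_trans; apply.
by rewrite /B (le_trans (ler_norm _))// lerDl.
Qed.

Let punctured w : set R[i] := [set w' | w' != w /\ 0 <= Imz w'].

Lemma coef_quotient_cvg q w x : slab_parameter a q -> 0 < Imz w -> x \in `[0, a] ->
  exists d : R[i], (fun w' => (coef q w' x - coef q w x) / (w' - w)) @
    within (punctured w) (nbhs w) --> d.
Proof.
move=> hq w0 xa; have [Phi cP PE] := coef_cdiff hq w0 xa; exists (Phi w).
apply/cvg_within_normcP => e /cP[d d0 dP]; exists d => // w' [wn _] wd.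
rewrite (PE w') (addrC (coef q w x)) addrK mulfK ?subr_eq0//.
exact: dP.
Qed.

(** By the Wronskian the difference quotient of psurf is an integral of difference quotients of the
    coefficients against products of the fields at [w] and [w']. The former converge for each x and
    are dominated, the latter are bounded and continuous in [w']. *)
Lemma psurf_cdiff w : 0 < Imz w -> cdiff psurf w.
Proof.
move=> w0; have cw : closed_upper_half w by exact: ltW.
have [L1 L10 hL1] := coef_lipschitz hC w0.
have [L2 L20 hL2] := coef_lipschitz hr w0.
have [K K0 hK] := fields_stability cw.
have nw1 : 0 < normc w + 1 by rewrite ltr_wpDl ?normc_ge0.
have [V V0 hV] := fields_uniform_bound nw1.
have wL : normc w <= normc w + 1 by rewrite lerDl.
pose D := punctured w.
have FF : Filter (within D (nbhs w)) by exact: within_filter.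
pose De q w' x := (coef q w' x - coef q w x) / (w' - w).
pose phi w' x := De rho' w' x * (vf w x * vf w' x) - De C' w' x * (pf w x * pf w' x).
have dq q : slab_parameter a q -> exists d : R -> R[i], forall x, x \in `[0, a] ->
    (fun w' => De q w' x) @ within D (nbhs w) --> d x.
  move=> hq; have : forall x, exists d : R[i], x \in `[0, a] ->
      (fun w' => De q w' x) @ within D (nbhs w) --> d.
    move=> x; have [xa|] := boolP (x \in `[0, a]); last by exists 0.
    by have [d dP] := coef_quotient_cvg hq w0 xa; exists d.
  by move=> /choice[d dP]; exists d.
have [d1 hd1] := dq _ hC; have [d2 hd2] := dq _ hr.
pose phi0 x := d2 x * (vf w x * vf w x) - d1 x * (pf w x * pf w x).
have subD (g : R[i] -> R[i]) (l : R[i]) : g @ within closed_upper_half (nbhs w) --> l ->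
    g @ within D (nbhs w) --> l.
  move=> /cvg_within_normcP h; apply/cvg_within_normcP => e /h[d d0 dP].
  by exists d => // w' [_ cw']; exact: dP.
have cvgv x : x \in `[0, a] -> (fun w' => vf w' x) @ within D (nbhs w) --> vf w x.
  move=> xa; apply: subD; apply: (stable_cvg (g := fun w' => vf w' x) cw K0).
  by move=> w' cw' ww; have [_ /(_ x xa)[]] := hK w' cw' ww.
have cvgp x : x \in `[0, a] -> (fun w' => pf w' x) @ within D (nbhs w) --> pf w x.
  move=> xa; apply: subD; apply: (stable_cvg (g := fun w' => pf w' x) cw K0).
  by move=> w' cw' ww; have [_ /(_ x xa)[]] := hK w' cw' ww.
have cst (k : R[i]) : (fun=> k) @ within D (nbhs w) --> k.
  by apply/cvg_within_normcP => e e0; exists 1 => // ? _ _; rewrite subrr normc0.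
have bDe q w' : slab_parameter a q -> closed_upper_half w' -> cbmeas 0 a (De q w').
  move=> hq cw'; apply: cbmeasM; last exact: cbmeas_cst.
  by apply: cbmeasB; apply: coef_cbmeas.
have bv w' : closed_upper_half w' -> cbmeas 0 a (vf w').
  by move=> cw'; have [[]] := slab_backed cw'.
have bp w' : closed_upper_half w' -> cbmeas 0 a (pf w').
  by move=> cw'; have [[]] := slab_backed cw'.
have lim : (fun w' => cint 0 a (phi w')) @ within D (nbhs w) --> cint 0 a phi0.
  (* Within [Imz w / 4] the Lipschitz bounds hold, within 1 the fields at [w'] are bounded by
     [V]. *)
  pose d0 := Num.min (Imz w / 4) 1.
  apply: (@cint_param_cvg _ 0 a D w phi phi0 (L2 * (V * V) + L1 * (V * V)) d0).
  - by rewrite lt_min ltr01 divr_gt0.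
  - move=> w' [_ cw'] _; apply: cbmeasB.
      by apply: cbmeasM; [exact: bDe|apply: cbmeasM; exact: bv].
    by apply: cbmeasM; [exact: bDe|apply: cbmeasM; exact: bp].
  - move=> w' x [wn cw']; rewrite lt_min => /andP[/ltW wr w1] xa.
    have wL' : normc w' <= normc w + 1.
      by rewrite -(subrK w w') (le_trans (normcD _ _))// addrC lerD2l ltW.
    have [v1 p1] := hV w x cw wL xa; have [v2 p2] := hV w' x cw' wL' xa.
    have wn0 : 0 < normc (w' - w) by rewrite normc_gt0 subr_eq0.
    apply: (le_trans (normcB _ _)); rewrite !normcM !normcV; apply: lerD.
      apply: ler_pM; rewrite ?mulr_ge0 ?invr_ge0 ?normc_ge0//.
        by rewrite ler_pdivrMr// hL2.
      by rewrite ler_pM ?normc_ge0.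
    apply: ler_pM; rewrite ?mulr_ge0 ?invr_ge0 ?normc_ge0//.
      by rewrite ler_pdivrMr// hL1.
    by rewrite ler_pM ?normc_ge0.
  - move=> x xa; apply: (complex_cvgD (FF := FF)); last apply: (complex_cvgN (FF := FF)).
      apply: (complex_cvgM (FF := FF)); first exact: hd2.
      by apply: (complex_cvgM (FF := FF)); [exact: cst|exact: cvgv].
    apply: (complex_cvgM (FF := FF)); first exact: hd1.
    by apply: (complex_cvgM (FF := FF)); [exact: cst|exact: cvgp].
pose k : R[i] := - (z / 2)%:C.
have : (fun w' => k * cint 0 a (phi w')) @ within D (nbhs w) --> k * cint 0 a phi0.
  by apply: (complex_cvgM (FF := FF)); [exact: cst|exact: lim].
move=> /cvg_within_normcP limk.
apply: (@quotient_cdiff _ _ _ (k * cint 0 a phi0)) => e /limk[d dp dP].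
exists (Num.min d (Imz w)) => [|w' wn]; first by rewrite lt_min dp.
rewrite lt_min => /andP[wd wi].
have cw' : closed_upper_half w'.
  by rewrite /closed_upper_half/= (le_trans _ (Im_near w w'))// subr_ge0 ltW.
have := dP w' (conj wn cw') wd; congr (normc (_ - _) < e).
rewrite (backed_field_diff a_ge0 z_gt0 (coef_cbmeas hC cw) (coef_cbmeas hr cw)
  (coef_cbmeas hC cw') (coef_cbmeas hr cw') (slab_backed cw) (slab_backed cw')).
rewrite -/k -mulrA; congr (_ * _); rewrite [RHS]mulrC -cintZ.
  by apply: eq_cint => x _; rewrite /phi /De; ring.
have bd q : slab_parameter a q -> cbmeas 0 a (fun x => coef q w' x - coef q w x).
  by move=> hq; apply: cbmeasB; exact: coef_cbmeas.
have bvv := cbmeasM (bv _ cw) (bv _ cw'); have bpp := cbmeasM (bp _ cw) (bp _ cw').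
exact: (cbmeasB (cbmeasM (bd _ hr) bvv) (cbmeasM (bd _ hC) bpp)).
Qed.

(* By [p(a) = 0], psurf(w) = - i w \int_0^a rho' v, and v tends to 2 / z. *)
Lemma psurf_near0 : exists2 K : R, 0 < K & exists2 d : R, 0 < d &
  forall w, closed_upper_half w -> normc w <= d ->
    normc (psurf w + 'i%C * w * (2 / z * rint 0 a (fun x => Rez (rho' x 0)))%:C) <=
      K * normc w ^+ 2.
Proof.
have [B B0 hB] := slab_common_bound.
have [V V0 hV] := fields_uniform_bound (@ltr01 R).
have [K1 [d d0 hd]] := slab_static_expansion hr.
(* Per unit of |w|, v deviates from 2 / z by |psurf| / z at the front face and by the integral of
   [coef C' w] times [pf w] inside. *)
pose K2 := (2 * (B * V * a)) / z + 2 * (B * V * a).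
have K20 : 0 < K2 by rewrite addr_gt0 ?divr_gt0 ?mulr_gt0.
(* The error of the static expansion of rho' against |v| <= V, plus the static density against the
   deviation of v. The sign of [K1] is not prescribed, hence its absolute value. *)
pose K3 := `|K1| * V + B * K2.
have K30 : 0 < K3 by rewrite ltr_wpDl ?mulr_gt0// mulr_ge0// ltW.
exists (2 * (K3 * a)); first by rewrite !mulr_gt0.
exists (Num.min d 1) => [|w cw]; first by rewrite lt_min d0 ltr01.
rewrite le_min => /andP[wd w1].
have c0 : closed_upper_half (0 : R[i]) by rewrite /closed_upper_half/=.
have [[bv bp vE pE] v0 p0 pa] := slab_backed cw.
have aa : a \in `[0, a] by rewrite in_itv/= a_ge0 lexx.
have b1 := coef_cbmeas hC cw; have b2 := coef_cbmeas hr cw.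
have bI : cbmeas 0 a (fun t => coef rho' w t * vf w t) by apply: cbmeasM.
have GE : psurf w = - cint 0 a (fun t => coef rho' w t * vf w t).
  by apply/eqP; rewrite -addr_eq0 -p0 -pE// pa.
have bound q u x : x \in `[0, a] -> normc (q x w) <= B -> normc (u x) <= V ->
    normc (coef q w x * u x) <= normc w * (B * V).
  by move=> xa h1 h2; rewrite normcM normc_coef -mulrA ler_wpM2l ?normc_ge0// ler_pM ?normc_ge0.
have G1 : normc (psurf w) <= normc w * (2 * (B * V * a)).
  rewrite GE normcN; apply: (le_trans (normc_cint_le (B := normc w * (B * V)) a_ge0 bI _)).
    move=> x xa; apply: bound => //; first by have [] := hB w x cw xa.
    by have [] := hV w x cw w1 xa.
  by apply: eq_ler; rewrite subr0; ring.
have zn : normc z%:C = z by rewrite normc_real ger0_norm// ltW.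
have hv x : x \in `[0, a] -> normc (vf w x - (2 / z)%:C) <= K2 * normc w.
  move=> xa; have [x0 xle] := itv_le_end xa.
  have e2 : (2 / z)%:C = 2 / z%:C :> R[i] by rewrite rmorphM fmorphV rmorph_nat.
  rewrite (vE _ xa) v0 e2 addrAC -mulrBl (_ : 2 - psurf w - 2 = - psurf w); last by ring.
  apply: (le_trans (normcD _ _)); rewrite /K2 mulrDl; apply: lerD.
    rewrite normcM normcN normcV zn mulrAC ler_pM2r ?invr_gt0//.
    by rewrite mulrC.
  have bx : cbmeas 0 x (fun t => coef C' w t * pf w t).
    by apply: (cbmeas_sub (lexx 0) xle); exact: cbmeasM.
  apply: (le_trans (normc_cint_le (B := normc w * (B * V)) x0 bx _)).
    move=> t tx; have ta : t \in `[0, a] by apply: subitv tx.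
    apply: bound => //; first by have [] := hB w t cw ta.
    by have [] := hV w t cw w1 ta.
  rewrite subr0; apply: (@le_trans _ _ (2 * (normc w * (B * V) * a))); last first.
    by apply: eq_ler; ring.
  have nBV : 0 <= normc w * (B * V) by rewrite !mulr_ge0 ?normc_ge0// ltW.
  by rewrite ler_pM2l// ler_wpM2l.
have bst : cbmeas 0 a (fun x => (Rez (rho' x 0))%:C).
  by apply: cbmeas_real; have [] := slab_cbmeas hr c0.
have -> : 'i%C * w * (2 / z * rint 0 a (fun x => Rez (rho' x 0)))%:C =
    cint 0 a (fun x => 'i%C * w * (2 / z)%:C * (Rez (rho' x 0))%:C).
  by rewrite cintZ// cint_real rmorphM mulrA.
rewrite GE addrC -cintB//; last exact: cbmeasZ.
apply: (le_trans (normc_cint_le (B := normc w * (K3 * normc w)) a_ge0 _ _)).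
- by apply: cbmeasB => //; exact: cbmeasZ.
- move=> x xa; have st : rho' x 0 = (Rez (rho' x 0))%:C.
    by apply: complex_ext => //=; exact: slab_static_real hr x xa.
  have -> : 'i%C * w * (2 / z)%:C * (Rez (rho' x 0))%:C - coef rho' w x * vf w x =
      'i%C * w * - ((rho' x w - rho' x 0) * vf w x + rho' x 0 * (vf w x - (2 / z)%:C)).
    by rewrite -st /coef; ring.
  rewrite !normcM normc_i mul1r normcN; apply: ler_wpM2l; first exact: normc_ge0.
  apply: (le_trans (normcD _ _)); rewrite !normcM /K3 [(_ + B * K2) * _]mulrDl; apply: lerD.
    have [h1 _] := hV w x cw w1 xa.
    rewrite mulrAC; apply: ler_pM; rewrite ?normc_ge0//.
    have := hd x w xa cw; rewrite !normc_val lecR => /(_ wd).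
    rewrite -rmorphM lecR => /le_trans; apply.
    by apply: ler_wpM2r; [exact: normc_ge0|exact: ler_norm].
  rewrite -mulrA; apply: ler_pM; rewrite ?normc_ge0//; last exact: hv.
  by have [] := hB 0 x c0 xa.
- by apply: eq_ler; rewrite subr0; ring.
Qed.

(** On this axis [- conjc w = w], so the real-response condition makes both coefficients real. The
    conjugate fields are then backed fields for the same coefficients, and the Wronskian formula
    equates their normalizations. *)
Lemma psurf_imaginary_axis (y : R) : 0 <= y -> Imz (psurf (0 +i* y)) = 0.
Proof.
move=> y0; set w := 0 +i* y; have cw : closed_upper_half w by [].
have wc : - conjc w = w by apply: complex_ext; rewrite /= ?oppr0 ?opprK.
have real q x : slab_parameter a q -> x \in `[0, a] -> conjc (coef q w x) = coef q w x.
  move=> hq xa; rewrite /coef !conjcM -(slab_real_response hq xa cw) wc; congr (_ * _).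
  by apply: complex_ext; rewrite ?(RezM, ImzM, Rez_conj, Imz_conj) /=; ring.
have b1 := coef_cbmeas hC cw; have b2 := coef_cbmeas hr cw.
have bk := slab_backed cw; have [F v0 p0 pa] := bk.
have bk' : backed_field a z (fun x => conjc (coef C' w x)) (fun x => conjc (coef rho' w x))
    (fun x => conjc (vf w x)) (fun x => conjc (pf w x)) (conjc (psurf w)).
  split.
  - exact: field_conj.
  - rewrite v0 conjcM rmorphB rmorph_nat; congr (_ * _).
    by rewrite conjc_inv conjc_real.
  - by rewrite p0.
  - by rewrite pa conjc0.
have := backed_field_diff a_ge0 z_gt0 b1 b2 (cbmeas_conj b1) (cbmeas_conj b2) bk bk'.
rewrite (@eq_cint _ 0 a _ (fun=> 0)); last first.
  by move=> x xa; rewrite !real// !subrr !mul0r subrr.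
rewrite cint_cst// mul0r mulr0 => /(congr1 (@complex.Im R)).
rewrite ImzB Imz_conj /=; lra.
Qed.

End Slab.

(** * The sum rule for a function on the upper half-plane *)

Section Half_plane_sum_rule.
Context {R : realType} (G : R[i] -> R[i]) (b K d : R).
Hypotheses (b_ge0 : 0 <= b) (K_gt0 : 0 < K) (d_gt0 : 0 < d).
Hypothesis G_diff : forall w, 0 < Imz w -> cdiff G w.
Hypothesis G_cont : forall w, closed_upper_half w ->
  G @ within closed_upper_half (nbhs w) --> G w.
Hypothesis G_bound : forall w, closed_upper_half w -> normc (G w) <= 2.
Hypothesis G_Re : forall w, closed_upper_half w -> 0 <= Rez (G w).
Hypothesis G_small : forall w, closed_upper_half w -> normc w <= d ->
  normc (G w + 'i%C * w * b%:C) <= K * normc w ^+ 2.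
Hypothesis G_axis : forall y : R, 0 <= y -> Imz (G (0 +i* y)) = 0.
Implicit Types (w : R[i]) (x t L : R).

(* G(w) / w^2 with its simple pole at 0 removed by a term whose real part on the
   real axis is - b / (1 + t^2). *)
Definition kernel w : R[i] := (G w + b%:C * ('i%C * w / (1 - 'i%C * w))) / w ^+ 2.

Lemma normc_one_sub_iw w : closed_upper_half w -> 1 <= normc (1 - 'i%C * w).
Proof.
move=> cw; apply: le_trans (Re_le_normc _); apply: le_trans (ler_norm _).
by rewrite RezB RezM /= mul0r mul1r sub0r opprK lerDl.
Qed.

Lemma one_sub_iw_neq0 w : closed_upper_half w -> 1 - 'i%C * w != 0.
Proof. by move=> cw; rewrite -normc_gt0; apply: lt_le_trans (normc_one_sub_iw cw). Qed.

Lemma kernel_far w : closed_upper_half w -> w != 0 ->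
  normc (kernel w) <= (2 + 2 * b) / normc w ^+ 2.
Proof.
move=> cw w0; rewrite /kernel normcM normcV normcX ler_pM2r; last first.
  by rewrite invr_gt0 exprn_gt0// normc_gt0.
apply: (le_trans (normcD _ _)); apply: lerD; first exact: G_bound.
rewrite normcM normc_real (ger0_norm b_ge0) mulrC; apply: ler_wpM2r => //.
have n0 := one_sub_iw_neq0 cw.
have -> : 'i%C * w / (1 - 'i%C * w) = (1 - 'i%C * w)^-1 - 1.
  by field.
apply: (le_trans (normcB _ _)); rewrite normc1 normcV (_ : 2 = 1 + 1)// lerD2r.
by rewrite invf_le1 ?normc_one_sub_iw// (lt_le_trans ltr01)// normc_one_sub_iw.
Qed.

Lemma kernel_near w : closed_upper_half w -> w != 0 -> normc w <= d ->
  normc (kernel w) <= K + b.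
Proof.
move=> cw w0 wd; have n0 := one_sub_iw_neq0 cw.
(* Because i w / (1 - i w) = i w + (i w)^2 / (1 - i w): the first-order term joins [G w], where
   [G_small] applies, and the rest loses its w^2. *)
have -> : kernel w = (G w + 'i%C * w * b%:C) / w ^+ 2 + b%:C * ('i%C ^+ 2 / (1 - 'i%C * w)).
  by rewrite /kernel; field; rewrite n0 w0.
apply: (le_trans (normcD _ _)); apply: lerD.
  rewrite normcM normcV normcX ler_pdivrMr ?exprn_gt0 ?normc_gt0//.
  exact: G_small.
rewrite (normcM b%:C) (normcM (_ ^+ 2)) normcV normcX normc_i expr1n mul1r.
rewrite normc_real (ger0_norm b_ge0).
by rewrite ler_piMr// invf_le1 ?normc_one_sub_iw// (lt_le_trans ltr01)// normc_one_sub_iw.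
Qed.

(** The bound near 0 plus the far bound at |w| = d; it is the dominating constant when the lower
    side descends to the real axis. *)
Definition kernel_bound : R := K + b + (2 + 2 * b) / d ^+ 2.

Lemma kernel_le w : closed_upper_half w -> w != 0 -> normc (kernel w) <= kernel_bound.
Proof.
move=> cw w0; have c0 : 0 <= 2 + 2 * b by rewrite addr_ge0// mulr_ge0.
have [wd|dw] := leP (normc w) d.
  by rewrite (le_trans (kernel_near cw w0 wd))// lerDl divr_ge0// exprn_ge0// ltW.
apply: (le_trans (kernel_far cw w0)); rewrite /kernel_bound.
rewrite (@le_trans _ _ ((2 + 2 * b) / d ^+ 2))//.
  by rewrite ler_wpM2l// lef_pV2 ?posrE ?exprn_gt0 ?normc_gt0// ler_sqr ?nnegrE ?normc_ge0 ?ltW.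
by rewrite lerDr addr_ge0// ltW.
Qed.

Lemma kernel_cdiff w : 0 < Imz w -> cdiff kernel w.
Proof.
move=> w0; have cw : closed_upper_half w by exact: ltW.
have wn0 : w != 0 by apply: contraTneq w0 => ->; rewrite ltxx.
have diw : cdiff (fun w => 'i%C * w) w by apply: cdiffM; [exact: cdiff_cst|exact: cdiff_id].
apply: cdiffM.
  apply: cdiffD; first exact: G_diff.
  apply: cdiffM; first exact: cdiff_cst.
  apply: cdiffM => //; apply: cdiffV; first exact: one_sub_iw_neq0.
  by apply: cdiffB => //; exact: cdiff_cst.
by apply: cdiffV; [rewrite expf_neq0|apply: cdiffM; exact: cdiff_id].
Qed.

Lemma kernel_cvg w : closed_upper_half w -> w != 0 ->
  kernel @ within closed_upper_half (nbhs w) --> kernel w.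
Proof.
move=> cw w0; have FF : Filter (within closed_upper_half (nbhs w)) by exact: within_filter.
have cst (k : R[i]) : (fun=> k) @ within closed_upper_half (nbhs w) --> k.
  by apply/cvg_within_normcP => e e0; exists 1 => // ? _ _; rewrite subrr normc0.
have id_cvg : (fun w' : R[i] => w') @ within closed_upper_half (nbhs w) --> w.
  by apply/cvg_within_normcP => e e0; exists e.
have iw : (fun w' => 'i%C * w') @ within closed_upper_half (nbhs w) --> 'i%C * w.
  by apply: (complex_cvgM (FF := FF)); [exact: cst|exact: id_cvg].
apply: (complex_cvgM (FF := FF)).
  apply: (complex_cvgD (FF := FF)); first exact: G_cont.
  apply: (complex_cvgM (FF := FF)); first exact: cst.
  apply: (complex_cvgM (FF := FF)); first exact: iw.
  apply: (complex_cvgV (FF := FF)); first exact: one_sub_iw_neq0.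
  apply: (complex_cvgD (FF := FF)); first exact: cst.
  by apply: (complex_cvgN (FF := FF)); exact: iw.
apply: (complex_cvgV (FF := FF)); first by rewrite expf_neq0.
by apply: (complex_cvgM (FF := FF)); exact: id_cvg.
Qed.

Lemma kernel_axis (y : R) : 0 < y -> Imz (kernel (0 +i* y)) = 0.
Proof.
move=> y0; rewrite /kernel.
have -> : G (0 +i* y) = (Rez (G (0 +i* y)))%:C.
  by apply: complex_ext => //=; rewrite G_axis// ltW.
move: (Rez _) => g.
have iy : 'i%C * (0 +i* y) = (- y)%:C :> R[i].
  by apply: complex_ext; rewrite ?(RezM, ImzM) /=; ring.
have y2 : (0 +i* y) ^+ 2 = (- y ^+ 2)%:C :> R[i].
  by rewrite expr2; apply: complex_ext; rewrite ?(RezM, ImzM) /=; ring.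
rewrite iy y2.
rewrite (_ : _ / _ = ((g + b * (- y / (1 - - y))) / - y ^+ 2)%:C)//.
by rewrite !(rmorphM, fmorphV, rmorphB, rmorph1, rmorphD).
Qed.

(** The top and right sides have length L and lie at distance at least L from 0, so each contributes
    at most 2 c / L with c = 2 + 2 b. The bound does not involve [e], hence survives its limit. *)
Lemma kernel_rect L e : 0 < L -> 0 < e ->
  `|rint 0 L (fun x => Rez (kernel (x +i* e)))| <= 4 * (2 + 2 * b) / L.
Proof.
move=> L0 e0; set c := 2 + 2 * b.
have c0 : 0 <= c by rewrite addr_ge0// mulr_ge0.
have eL : e <= e + L by rewrite lerDl ltW.
have dk x y : e <= y -> cdiff kernel (x +i* y).
  by move=> ey; apply: kernel_cdiff; exact: lt_le_trans ey.
have bh y : e <= y -> cbmeas 0 L (fun x => kernel (x +i* y)).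
  move=> ey; apply: cbmeas_continuous_in => x _; apply: continuous_hline.
  by apply: cdiff_continuous; exact: dk.
have bv x : cbmeas e (e + L) (fun y => kernel (x +i* y)).
  apply: cbmeas_continuous_in => y; rewrite in_itv/= => /andP[ey _].
  by apply: continuous_vline; apply: cdiff_continuous; exact: dk.
have : rectint kernel 0 L e (e + L) = 0.
  apply: goursat; [exact: ltW|exact: eL|].
  by move=> [x y] [_ _ ey _]; apply: dk; exact: ey.
rewrite /rectint cintB; [|exact: bh|exact: bh].
rewrite cintB; [|exact: bv|exact: bv].
set I1 := cint 0 L _; set I2 := cint 0 L _; set I3 := cint e _ _; set I4 := cint e _ _.
move=> rect0.
have far w : closed_upper_half w -> L <= normc w -> normc (kernel w) <= c / L ^+ 2.
  move=> cw Lw; have w0 : 0 < normc w by exact: lt_le_trans Lw.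
  apply: (le_trans (kernel_far cw _)); first by rewrite -normc_gt0.
  rewrite ler_wpM2l// lef_pV2 ?posrE ?exprn_gt0//.
  by apply: lerXn2r; rewrite ?nnegrE ?(ltW L0) ?(ltW w0).
have N2 : normc I2 <= 2 * (c / L ^+ 2 * (L - 0)).
  apply: normc_cint_le; [exact: ltW|exact: bh|move=> x _; apply: far].
    by rewrite /closed_upper_half/= addr_ge0// ltW.
  apply: le_trans (Im_le_normc _); apply: le_trans (ler_norm _) => /=.
  by rewrite lerDr ltW.
have N3 : normc I3 <= 2 * (c / L ^+ 2 * (e + L - e)).
  apply: normc_cint_le; [exact: eL|exact: bv|].
  move=> y; rewrite in_itv/= => /andP[ey _]; apply: far.
    by rewrite /closed_upper_half/= (le_trans _ ey)// ltW.
  by apply: le_trans (Re_le_normc _); apply: le_trans (ler_norm _).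
(* The kernel is real on the imaginary axis. *)
have R4 : Imz I4 = 0.
  rewrite /I4 Im_cint (@eq_rint _ _ _ _ (fun=> 0)).
    by rewrite rint_cst// mul0r.
  move=> y; rewrite in_itv/= => /andP[ey _]; apply: kernel_axis.
  exact: lt_le_trans ey.
(* The vertical sides carry the factor i, so the left one enters the real part only through
   [Imz I4]. *)
have E1 : Rez I1 = Rez I2 + Imz I3.
  have := congr1 (@complex.Re R) rect0.
  by rewrite RezD RezB RezM ImzB R4 /=; lra.
rewrite -Re_cint -/I1 E1 (le_trans (ler_normD _ _))//.
apply: (le_trans (lerD (le_trans (Re_le_normc _) N2) (le_trans (Im_le_normc _) N3))).
by apply: eq_ler; field; rewrite gt_eqF.
Qed.

Definition sum_rule_integrand t : R := Rez (G t%:C) / t ^+ 2.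
Local Notation f := sum_rule_integrand.

Lemma kernel_real t : 0 < t -> Rez (kernel t%:C) = f t - b / (1 + t ^+ 2).
Proof.
move=> t0; rewrite /kernel /f -rmorphXn /= -fmorphV RezM /= mulr0 subr0.
have -> : 'i%C * t%:C / (1 - 'i%C * t%:C) =
    (- t ^+ 2 / (1 + t ^+ 2)) +i* (t / (1 + t ^+ 2)) :> R[i].
  have n1 : 1 + t ^+ 2 != 0 by rewrite gt_eqF// ltr_pwDl// sqr_ge0.
  have ct : closed_upper_half (t%:C : R[i]) by rewrite /closed_upper_half/=.
  have n0 := one_sub_iw_neq0 ct; apply: (mulIf n0); rewrite divfK//.
  apply: complex_ext; rewrite ?(RezM, ImzM, RezB, ImzB) /=; field; exact: n1.
rewrite RezD RezM /= mul0r subr0 mulrDl; congr (_ + _).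
have n1 : 1 + t ^+ 2 != 0 by rewrite gt_eqF// ltr_pwDl// sqr_ge0.
by field; rewrite n1 gt_eqF.
Qed.

Lemma integrand_ge0 t : 0 <= f t.
Proof.
by rewrite divr_ge0 ?sqr_ge0// G_Re// /closed_upper_half/=.
Qed.

Lemma integrand_measurable : measurable_fun (`]0, +oo[ : set R) f.
Proof.
apply: open_continuous_measurable_fun => // t; rewrite inE/= in_itv/= andbT => t0.
have ct : closed_upper_half (t%:C : R[i]) by rewrite /closed_upper_half/=.
apply: cvgM; last first.
  by apply: cvgV; [rewrite expf_neq0// gt_eqF|exact: exprn_continuous].
have /cvg_within_normcP h := G_cont ct.
apply/cvgrPdist_lt => e /h[r r0 rP]; apply/nbhs_ballP; exists r => //= s.
rewrite /ball/= distrC => sr; apply: le_lt_trans (rP s%:C _ _).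
- by rewrite -RezB normcBC Re_le_normc.
- by rewrite /closed_upper_half/=.
- by rewrite -rmorphB normc_real.
Qed.

Lemma integrand_bmeas L : 0 < L -> bmeas 0 L f.
Proof.
move=> L0; split.
  apply/measurable_fun_itv_obnd_cbndP; apply: measurable_funS integrand_measurable => //.
  by move=> x /=; rewrite !in_itv/= => /andP[-> _].
exists (kernel_bound + b) => x; rewrite in_itv/= => /andP[x0 _].
have Kb0 : 0 <= kernel_bound.
  by rewrite /kernel_bound !addr_ge0 ?divr_ge0 ?exprn_ge0 ?addr_ge0 ?mulr_ge0 ?(ltW K_gt0)// ltW.
(* At the origin the integrand is 0 by the convention on division by zero. *)
move: x0; rewrite le_eqVlt => /predU1P[<-|x0].
  by rewrite /f expr0n /= invr0 mulr0 normr0 addr_ge0.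
have cx : closed_upper_half (x%:C : R[i]) by rewrite /closed_upper_half/=.
have xn : x%:C != 0 :> R[i] by rewrite fmorph_eq0 gt_eqF.
have -> : f x = Rez (kernel x%:C) + b / (1 + x ^+ 2) by rewrite kernel_real// subrK.
apply: (le_trans (ler_normD _ _)); apply: lerD.
  exact: le_trans (Re_le_normc _) (kernel_le cx xn).
have x1 : 1 <= 1 + x ^+ 2 by rewrite lerDl sqr_ge0.
rewrite ger0_norm; last by rewrite divr_ge0// (le_trans _ x1).
by rewrite ler_piMr// invf_le1// (lt_le_trans _ x1).
Qed.

Lemma lorentzian_bmeas L : 0 < L -> bmeas 0 L (fun t => b / (1 + t ^+ 2)).
Proof.
move=> L0; apply: bmeas_continuous; apply: continuous_subspaceT => t.
by apply: cvgMr; exact: continuous_oneDsqrV.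
Qed.

(** The limit of [kernel_rect] as the lower side reaches the real axis, where the real part of the
    kernel is the integrand minus b / (1 + t^2), whose second term integrates to b atan L. *)
Lemma integrand_truncated L : 0 < L ->
  `|rint 0 L f - b * atan L| <= 4 * (2 + 2 * b) / L.
Proof.
move=> L0; have bf := integrand_bmeas L0; have bl := lorentzian_bmeas L0.
have -> : rint 0 L f - b * atan L = rint 0 L (fun t => f t - b / (1 + t ^+ 2)).
  rewrite (rintD bf (bmeasN bl)) rintN//; congr (_ - _).
  rewrite -(integral0_oneDsqr (ltW L0)) -/(rint 0 L _) -rintZ//.
  apply: bmeas_continuous; apply: continuous_subspaceT => t.
  exact: continuous_oneDsqrV.
pose e (n : nat) : R := n.+1%:R^-1.
have e0 n : 0 < e n by rewrite invr_gt0.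
have lim : (fun n => rint 0 L (fun x => Rez (kernel (x +i* e n)))) @ \oo -->
    rint 0 L (fun t => f t - b / (1 + t ^+ 2)).
  (* The last argument exempts the origin, where [kernel_cvg] does not apply. *)
  apply: (@rint_bounded_cvg _ 0 L (fun n x => Rez (kernel (x +i* e n))) _ kernel_bound 0).
  - move=> n; apply: (proj1 (_ : cbmeas 0 L (fun x => kernel (x +i* e n)))).
    apply: cbmeas_continuous_in => x _; apply: continuous_hline.
    by apply: cdiff_continuous; apply: kernel_cdiff => /=.
  - exact: bmeasB.
  - move=> n x _; apply: (le_trans (Re_le_normc _)); apply: kernel_le.
      by rewrite /closed_upper_half/= ltW.
    by apply/eqP => /(congr1 (@complex.Im R)) /= en; have := e0 n; rewrite en ltxx.
  - move=> x; rewrite in_itv/= => /andP[x0 _] xn.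
    have {x0 xn}x0 : 0 < x by rewrite lt_def xn.
    rewrite -kernel_real//; apply: cvg_Re.
    have cx : closed_upper_half (x%:C : R[i]) by rewrite /closed_upper_half/=.
    have xC : x%:C != 0 :> R[i] by rewrite fmorph_eq0 gt_eqF.
    (* The distance to the limit point is exactly 1 / (n + 1) and the required inequality is strict,
       hence 2 rather than 1. *)
    apply: (cvg_seq_within (d0 := 2) (u := fun n => x +i* e n) _ _ _ (kernel_cvg cx xC)) => //.
      by move=> n; rewrite /closed_upper_half/= ltW.
    move=> n; have -> : x +i* e n - x%:C = 'i%C * (e n)%:C.
      by apply: complex_ext; rewrite ?(RezM, ImzM, RezB, ImzB) /=; ring.
    rewrite normcM normc_i mul1r normc_real ger0_norm ?(ltW (e0 n))//.
    by rewrite -[ltLHS]mul1r ltr_pM2r// ltr1n.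
have ln : (fun n => `|rint 0 L (fun x => Rez (kernel (x +i* e n)))|) @ \oo -->
    `|rint 0 L (fun t => f t - b / (1 + t ^+ 2))| by apply: cvg_norm.
have /cvg_lim <- // := ln.
apply: limr_le; first by apply/cvg_ex; eexists; exact: ln.
by apply: nearW => n; exact: kernel_rect.
Qed.

(** The integrand is nonnegative, so monotone convergence along [0, n + 1] identifies the integral
    with the limit of the truncated ones; its finiteness is the integrability. *)
Theorem half_plane_sum_rule :
  mu.-integrable (`]0, +oo[ : set R) (EFin \o f) /\
  (\int[mu]_(t in `]0%R, +oo[) (f t)%:E = (b * (pi / 2))%:E)%E.
Proof.
have mf : measurable_fun (`[0, +oo[ : set R) (EFin \o f).
  apply/measurable_EFinP; apply/measurable_fun_itv_obnd_cbndP.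
  exact: integrand_measurable.
have I0 : (\int[mu]_(t in `]0%R, +oo[) (f t)%:E = \int[mu]_(t in `[0%R, +oo[) (f t)%:E)%E.
  rewrite integral_itv_obnd_cbnd//; apply/measurable_EFinP.
  exact: integrand_measurable.
(* The shift by one keeps the length positive for every [n], as the truncated estimates require. *)
pose F (n : nat) : set R := `[0%R, n.+1%:R]%classic.
have limF : (\int[mu]_(t in F n) (f t)%:E @[n --> \oo] -->
             \int[mu]_(t in \bigcup_n F n) (f t)%:E)%E.
  apply: ge0_nondecreasing_set_cvg_integral => //.
  - apply/nondecreasing_seqP => n; rewrite subsetEset => x.
    rewrite /F /= !in_itv/= => /andP[-> xn]; rewrite (le_trans xn)// ler_nat.
    by [].
  - by move=> n; exact: measurable_itv.
  - by move=> n; apply: (measurable_funS _ _ mf) => // x; rewrite /F /= !in_itv/= => /andP[->].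
  - by move=> n x _; rewrite lee_fin integrand_ge0.
have UF : \bigcup_n F n = `[0, +oo[%classic.
  apply/seteqP; split => x /=.
    by case=> n _; rewrite /F /= !in_itv/= => /andP[->].
  rewrite in_itv/= andbT => x0; exists (Num.truncn x) => //.
  by rewrite /F /= in_itv/= x0/= ltW// truncnS_gt.
have FE n : (\int[mu]_(t in F n) (f t)%:E = (rint 0 n.+1%:R f)%:E)%E.
  rewrite /rint /Rintegral fineK//; apply: integrable_fin_num => //.
  by apply: bmeas_integrable; exact: integrand_bmeas.
have limR : (fun n => rint 0 n.+1%:R f) @ \oo --> b * (pi / 2).
  have l1 : (fun n : nat => b * atan (n.+1%:R : R)) @ \oo --> b * (pi / 2).
    apply: cvgMr; apply: (@cvg_comp _ _ _ (fun n : nat => n.+1%:R : R) atan _ +oo%R).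
      apply/cvgryPge => r; exists (Num.truncn r) => // n /= rn.
      by rewrite (le_trans (ltW (truncnS_gt r)))// ler_nat.
    exact: cvgy_atan.
  have l2 : (fun n => rint 0 n.+1%:R f - b * atan n.+1%:R) @ \oo --> (0 : R).
    have l3 : (fun n : nat => 4 * (2 + 2 * b) * (n.+1%:R)^-1) @ \oo --> (4 * (2 + 2 * b) * 0 : R).
      by apply: cvgMr; exact: cvg_harmonic.
    rewrite mulr0 in l3; apply/cvgr0Pnorm_le => e e0.
    move/cvgr0Pnorm_le/(_ e e0) : l3; apply: filterS => n; apply: le_trans.
    apply: (le_trans (integrand_truncated _)); first by rewrite ltr0n.
    by rewrite ler_norm.
  rewrite (_ : (fun n => _) =
      (fun n => (rint 0 n.+1%:R f - b * atan n.+1%:R) + b * atan n.+1%:R)).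
    by rewrite -[X in _ --> X]add0r; exact: cvgD.
  by apply/funext => n; rewrite subrK.
have val : (\int[mu]_(t in `[0%R, +oo[) (f t)%:E = (b * (pi / 2))%:E)%E.
  have limE : (\int[mu]_(t in F n) (f t)%:E @[n --> \oo] --> (b * (pi / 2))%:E)%E.
    rewrite (_ : (fun n => _) = EFin \o (fun n : nat => rint 0 n.+1%:R f)).
      by apply: cvg_EFin; [exact: nearW|exact: limR].
    by apply/funext => n; exact: FE.
  by rewrite -UF; exact: (cvg_unique _ limF limE).
split; last by rewrite I0.
apply/integrableP; split; first by apply/measurable_EFinP; exact: integrand_measurable.
under eq_integral do rewrite /= ger0_norm ?integrand_ge0//.
by rewrite I0 val ltry.
Qed.

End Half_plane_sum_rule.

(** * The sum rule for the slab *)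

Unset Implicit Arguments.

Theorem mainTheorem6 (R : realType) (rho C a : R)
    (rho' C' : R -> R[i] -> R[i]) (M : R -> R[i] -> 'M[R[i]]_2)
    (rho_gt0 : 0 < rho) (C_gt0 : 0 < C) (a_gt0 : 0 < a)
    (hrho' : slab_parameter a rho') (hC' : slab_parameter a C')
    (hM : forall w : R[i], closed_upper_half w ->
      is_propagator a rho' C' w (fun x => M x w)) :
  let c : R := (Num.sqrt (C * rho))^-1 in
  let z : R := Num.sqrt (rho / C) in
  let refl : R -> R[i] := fun w => soft_reflection z (M a w%:C) in
  let f : R -> R := fun w => complex.Re (1 + refl w) / w ^+ 2 in
  lebesgue_measure.-integrable `]0, +oo[ (fun w => (f w)%:E) /\
  (\int[lebesgue_measure]_(w in `]0%R, +oo[) (f w)%:E =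
     (pi * a / c * (slab_mean a (fun x => complex.Re (rho' x 0)) / rho))%:E)%E.
Proof.
move=> c z refl f.
have z_gt0 : 0 < z by rewrite sqrtr_gt0 divr_gt0.
pose A := rint 0 a (fun x => Rez (rho' x 0)).
have A_ge0 : 0 <= A.
  apply: rint_ge0 => x xa; have [m m0 mP] := slab_static_pos hrho'.
  by rewrite (le_trans (ltW m0))// mP.
have b_ge0 : 0 <= 2 / z * A by rewrite mulr_ge0// divr_ge0// ltW.
have [K K0 [d d0 small]] := psurf_near0 a_gt0 z_gt0 hrho' hC' hM.
have [intf valf] := half_plane_sum_rule b_ge0 K0 d0
  (psurf_cdiff a_gt0 z_gt0 hrho' hC' hM) (psurf_cvg a_gt0 z_gt0 hrho' hC' hM)
  (normc_psurf a_gt0 z_gt0 hrho' hC' hM) (Re_psurf_ge0 a_gt0 z_gt0 hrho' hC' hM)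
  small (psurf_imaginary_axis a_gt0 z_gt0 hrho' hC' hM).
split; first exact: intf.
have -> : pi * a / c * (slab_mean a (fun x => complex.Re (rho' x 0)) / rho) =
    2 / z * A * (pi / 2).
  have -> : slab_mean a (fun x => complex.Re (rho' x 0)) = a^-1 * A by [].
  (* The product of the square roots of C rho and rho / C is rho; this turns b pi / 2 = pi A / z
     into the stated value. *)
  have cz : c^-1 = rho / z.
    have zn0 : z != 0 by rewrite gt_eqF.
    apply: (mulIf zn0); rewrite divfK// invrK -sqrtrM; last by rewrite mulr_ge0// ltW.
    have -> : C * rho * (rho / C) = rho ^+ 2 by field; rewrite gt_eqF.
    by rewrite sqrtr_sqr gtr0_norm.
  by rewrite cz; field; rewrite !gt_eqF.
exact: valf.
Qed.
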